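(* Let $K$ be a discretely valued field with ring of integers $\mathcal{O}_K$ and residue field $k$, let $V$ be a $K$-vector space of dimension $d$, and let $\Gamma$ be a finite set of homothety classes of quotient lattices in $V$. Then the primary and secondary components of the special fibre $\mathcal{M}(\Gamma)_k$ of the Mustafin degeneration $\mathcal{M}(\Gamma)$ are generalised multi-view varieties over $k$.
   Context: A lattice in $V$ is a free rank $d$ $\mathcal{O}_K$-submodule $L$ of $V$. If $M\subset L$ is a free submodule such that $L/M$ is a free module, then $L/M$ is called a quotient lattice (assumed nonzero). Its homothety class is $[L/M]=\{(\alpha L)/(\alpha M)\mid \alpha\in K^*\}$. Projective spaces parametrise lines: $\mathbb{P}(V)=\mathrm{Proj}\,\mathrm{Sym}(V^* )$ and, for a quotient lattice $L/M$, $\mathbb{P}(L/M)=\mathrm{Proj}\,\mathrm{Sym}(\mathrm{Hom}_{\mathcal{O}_K}(L/M,\mathcal{O}_K))$, a projective space over $\mathcal{O}_K$ whose generic fibre is $\mathbb{P}(V/\langle M\rangle_K)$, where $\langle M\rangle_K\subset V$ is the $K$-span of $M$. For $\Gamma=\{[L_1/M_1],\dots,[L_n/M_n]\}$, let $f_i:\mathbb{P}(V)\dashrightarrow\mathbb{P}(L_i/M_i)$ be the canonical rational map onto the generic fibre, induced by $V\to V/\langle M_i\rangle_K$. The Mustafin degeneration $\mathcal{M}(\Gamma)$ is the closure of the image of $(f_1,\dots,f_n):\mathbb{P}(V)\dashrightarrow\prod_{i=1}^n\mathbb{P}(L_i/M_i)$ (fibre product over $\mathcal{O}_K$), endowed with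 the reduced scheme structure. Its special fibre is denoted $\mathcal{M}(\Gamma)_k$. A choice of $\mathcal{O}_K$-basis of each $L_i/M_i$ identifies $\prod_i\mathbb{P}(L_i/M_i)_k$ with $\prod_i\mathbb{P}^{l_i-1}_k$, where $l_i=\mathrm{rank}(L_i/M_i)$. Primary and secondary components: let $C$ be an irreducible component of $\mathcal{M}(\Gamma)_k$. $C$ is called primary if it projects birationally onto $\mathbb{P}(L_i/M_i)_k$ for some $i$ under the natural projection $\mathcal{M}(\Gamma)\to\mathbb{P}(L_i/M_i)$. $C$ is called secondary if it is not primary and there exists a class of quotient lattices $[L/M]$ such that some primary component of $\mathcal{M}(\Gamma\cup\{[L/M]\})_k$ projecting birationally onto $\mathbb{P}(L/M)_k$ also projects birationally onto $C$ under the natural projection $\mathcal{M}(\Gamma\cup\{[L/M]\})\to\mathcal{M}(\Gamma)$. Generalised multi-view variety over a field $F$: given positive integers $d,n,l_1,\dots,l_n$ with $l_i\le d$ and (nonzero) $l_i\times d$ matrices $A_i$ over $F$, it is the closure $M_{\underline{A}}$ of the image of the rational map $\mathbb{P}^{d-1}_F\dashrightarrow\prod_{i=1}^n\mathbb{P}^{l_i-1}_F$, $x\mapsto(A_1x,\dots,A_nx)$. The components, considered with their reduced structure, are regarded as subvarieties of $\prod_i\mathbb{P}^{l_i-1}_k$ via the identification above. *)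

(* Defs.v *)
From HB Require Import structures.
From mathcomp Require Import all_boot all_order all_algebra.
From mathcomp Require Import mpoly.

Set Implicit Arguments.
Unset Strict Implicit.
Unset Printing Implicit Defensive.

Import Order.TTheory GRing.Theory Num.Theory.
Local Open Scope ring_scope.

(******************************************************************************)
(* Discretely valued fields                                                   *)
(******************************************************************************)

(* Normalised, so that the value group is the whole of int; the value at 0    *)
(* (conventionally +oo) is junk and is never used.                            *)
Record discrete_valuation (K : fieldType) := DiscreteValuation {
  dval :> K -> int;
  dvalM : forall x y, x != 0 -> y != 0 -> dval (x * y) = dval x + dval y;
  dvalD : forall x y, x != 0 -> y != 0 -> x + y != 0 ->
    Num.min (dval x) (dval y) <= dval (x + y);
  dval_surj : forall z : int, exists2 x, x != 0 & dval x = z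
}.

Definition integral (K : fieldType) (v : discrete_valuation K) : K -> bool :=
  fun x => (x == 0) || (0 <= v x).

Fact integral_subring (K : fieldType) (v : discrete_valuation K) :
  subring_closed (integral v).
Proof.
have v1 : v 1 = 0.
  by apply: (@addrI _ (v 1)); rewrite addr0 -dvalM ?oner_neq0// mulr1.
have vN1 : v (- 1) = 0.
  have N1 : (- 1 : K) != 0 by rewrite oppr_eq0 oner_neq0.
  have := dvalM v N1 N1; rewrite mulrNN mulr1 v1 => /esym/eqP.
  by rewrite -mulr2n mulrn_eq0 => /eqP.
have vN x : x != 0 -> v (- x) = v x.
  by move=> x0; rewrite -mulN1r dvalM ?vN1 ?add0r// oppr_eq0 oner_neq0.
split=> [|x y|x y]; rewrite !unfold_in /integral.
- by rewrite v1 lexx orbT.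
- have [->|x0] := eqVneq x 0; have [->|y0] := eqVneq y 0.
  + by rewrite subr0 eqxx.
  + by rewrite sub0r oppr_eq0 vN// (negPf y0).
  + by rewrite subr0 (negPf x0).
  + have [//|xy0] := eqVneq (x - y) 0; rewrite /= => vx vy.
    apply: le_trans (dvalD v x0 _ xy0); last by rewrite oppr_eq0.
    by rewrite vN// le_min vx.
- have [->|x0] := eqVneq x 0; first by rewrite mul0r eqxx.
  have [->|y0] := eqVneq y 0; first by rewrite mulr0 eqxx.
  by rewrite /= => vx vy; rewrite dvalM// addr_ge0 ?orbT.
Qed.

HB.instance Definition _ (K : fieldType) (v : discrete_valuation K) :=
  GRing.isSubringClosed.Build K (integral v) (integral_subring v).

Record integers (K : fieldType) (v : discrete_valuation K) := Integer {
  integer_val :> K;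
  integer_valP : integer_val \in integral v
}.

HB.instance Definition _ (K : fieldType) (v : discrete_valuation K) :=
  [isSub for @integer_val K v].
HB.instance Definition _ (K : fieldType) (v : discrete_valuation K) :=
  [Choice of integers v by <:].
HB.instance Definition _ (K : fieldType) (v : discrete_valuation K) :=
  [SubChoice_isSubComNzRing of integers v by <:].

(* k, with pi, is the quotient of the ring of integers by its maximal ideal.  *)
Definition is_residue_field (K : fieldType) (v : discrete_valuation K)
    (k : fieldType) (pi : {rmorphism integers v -> k}) : Prop :=
  (forall a : k, exists x, pi x = a) /\
  (forall x : integers v, pi x = 0 <-> ((x : K) = 0 \/ 0 < v x)).

(******************************************************************************)
(* Quotient lattices                                                          *)
(******************************************************************************)

Section Lattices.
Variables (K : fieldType) (v : discrete_valuation K) (V : vectType K).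

Definition icomb r (X : r.-tuple V) (a : 'I_r -> integers v) : V :=
  \sum_(i < r) integer_val (a i) *: tnth X i.

(* L is a free submodule over the integers, with basis X *)
Definition integral_basis r (X : r.-tuple V) (L : V -> Prop) : Prop :=
  (forall u, L u <-> exists a, u = icomb X a) /\
  (forall a, icomb X a = 0 -> forall i, a i = 0).

Definition lattice (L : V -> Prop) : Prop :=
  exists b : (\dim {:V}).-tuple V, integral_basis b L.

(* the classes modulo M of the entries of e form a basis of L / M *)
Definition quotient_basis r (e : r.-tuple V) (L M : V -> Prop) : Prop :=
  [/\ forall j, L (tnth e j),
      forall u, L u -> exists a, M (u - icomb e a)
    & forall a, M (icomb e a) -> forall i, a i = 0].

(* A nonzero quotient lattice L / M, together with (lifts to L of) a chosen   *)
(* basis of L / M, and a chosen basis of M.                                   *)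
Record quotLattice := QuotLattice {
  qlL : V -> Prop;
  qlM : V -> Prop;
  qlL_lattice : lattice qlL;
  qlM_sub : forall u, qlM u -> qlL u;
  qlM_rank : nat;
  qlM_basis : qlM_rank.-tuple V;
  qlM_basisP : integral_basis qlM_basis qlM;
  qlrank : nat;
  qlrank_gt0 : (0 < qlrank)%N;
  qlbasis : qlrank.-tuple V;
  qlbasisP : quotient_basis qlbasis qlL qlM
}.

(* equality of homothety classes; the chosen bases are irrelevant *)
Definition homothetic (q q' : quotLattice) : Prop :=
  exists2 alpha : K, alpha != 0 &
    (forall u, qlL q' (alpha *: u) <-> qlL q u) /\
    (forall u, qlM q' (alpha *: u) <-> qlM q u).

(* qlbasis q followed by qlM_basis q is a K-basis of V whose second part      *)
(* spans <M>_K, so that the coordinates along the first part are those of the *)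
(* projection V -> V / <M>_K in the basis induced by qlbasis q.               *)
Definition qlcoord (q : quotLattice) (j : 'I_(qlrank q)) (u : V) : K :=
  coord [tuple of qlbasis q ++ qlM_basis q] (lshift (qlM_rank q) j) u.

(* matrix of V -> V / <M>_K; V has the basis vbasis {:V} *)
Definition qlmx (q : quotLattice) : 'M[K]_(qlrank q, \dim {:V}) :=
  \matrix_(j, c) qlcoord j (tnth (vbasis {:V}) c).

End Lattices.

(******************************************************************************)
(* Products of projective spaces                                              *)
(******************************************************************************)

(* The fibre product over R of the spaces P^(l i - 1)_R, i : I, is            *)
(* represented through its underlying topological space: its points are the   *)
(* multihomogeneous prime ideals of the multigraded coordinate ring           *)
(* R[x_(i,j) | i : I, j < l i] containing no irrelevant ideal                 *)
(* (x_(i,j) | j < l i), and its closed sets are the zero loci of sets of      *)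
(* polynomials. Integral closed subschemes are determined by their            *)
(* underlying closed sets.                                                    *)

Section MultiProj.
Variables (I : finType) (l : I -> nat).

Definition nvars : nat := #|{: {i : I & 'I_(l i)}}|.

Definition cvar (i : I) (j : 'I_(l i)) : 'I_nvars :=
  enum_rank (Tagged (fun i => 'I_(l i)) j).

Definition multideg (m : 'X_{1..nvars}) : {ffun I -> nat} :=
  [ffun i => \sum_(j < l i) m (cvar j)]%N.

Variable R : comNzRingType.

Definition multihomog (e : {ffun I -> nat}) (f : {mpoly R[nvars]}) : Prop :=
  forall m, m \in msupp f -> multideg m = e.

Definition multicomp (e : {ffun I -> nat}) (f : {mpoly R[nvars]}) :
    {mpoly R[nvars]} :=
  \sum_(m <- msupp f | multideg m == e) f@_m *: 'X_[m].

Definition pt : Type := {mpoly R[nvars]} -> Prop.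

Record is_point (P : pt) : Prop := IsPoint {
  point0 : P 0;
  pointD : forall f g, P f -> P g -> P (f + g);
  pointM : forall f g, P f -> P (g * f);
  point1 : ~ P 1;
  point_prime : forall f g, P (f * g) -> P f \/ P g;
  point_homog : forall f, P f -> forall e, P (multicomp e f);
  point_relevant : forall i, exists j : 'I_(l i), ~ P 'X_(cvar j)
}.

Definition zeros (E : {mpoly R[nvars]} -> Prop) (P : pt) : Prop :=
  is_point P /\ forall f, E f -> P f.

Definition zclosure (Z : pt -> Prop) (P : pt) : Prop :=
  forall E, (forall Q, Z Q -> zeros E Q) -> zeros E P.

Definition zirreducible (Z : pt -> Prop) : Prop :=
  [/\ forall P, Z P -> is_point P,
      exists P, Z P
    & forall E1 E2, (forall P, Z P -> zeros E1 P \/ zeros E2 P) ->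
        (forall P, Z P -> zeros E1 P) \/ (forall P, Z P -> zeros E2 P)].

Definition irreducible_component (X C : pt -> Prop) : Prop :=
  [/\ zirreducible C,
      forall P, C P -> X P
    & forall D : pt -> Prop, zirreducible D -> (forall P, D P -> X P) ->
        (forall P, C P -> D P) -> forall P, D P -> C P].

Definition generic_point (Z : pt -> Prop) (P : pt) : Prop :=
  Z P /\ forall Q, Z Q -> forall f, P f -> Q f.

End MultiProj.

(* P^(d-1)_F is the case of a single factor *)
Definition unit_dim (d : nat) : unit -> nat := fun=> d.

Section RationalMap.
Variables (I : finType) (l : I -> nat) (R F : comNzRingType).
Variables (iota : R -> F) (d : nat) (A : forall i, 'M[F]_(l i, d)).

Let SF := {mpoly F[nvars (unit_dim d)]}.

Definition linform (i : I) (j : 'I_(l i)) : SF :=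
  \sum_(c < d) A i j c *: 'X_(@cvar _ (unit_dim d) tt c).

(* f(x_(i,j)) |-> f((A_i x)_j); iota is always a ring morphism below *)
Definition linsubst (f : {mpoly R[nvars l]}) : SF :=
  mmap (fun c => (iota c)%:MP)
       (fun w => linform (tagged (enum_val w : {i : I & 'I_(l i)}))) f.

Definition linmap_dom (P : pt (unit_dim d) F) : Prop :=
  forall i, exists j : 'I_(l i), ~ P (linform j).

(* The vectors A_i x are defined up to independent scalars, so substitution   *)
(* only makes sense on multihomogeneous f.                                    *)
Definition linmap_pt (P : pt (unit_dim d) F) : pt l R :=
  fun f => forall e, P (linsubst (multicomp e f)).

(* image of x |-> (A_i x)_i, from P^(d-1)_F to the product over R of the      *)
(* P^(l i - 1)_R                                                              *)
Definition linmap_image (Q : pt l R) : Prop :=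
  exists P, [/\ is_point P, linmap_dom P & forall f, Q f <-> linmap_pt P f].

End RationalMap.

Definition is_multiview (I : finType) (l : I -> nat) (F : fieldType)
    (C : pt l F -> Prop) : Prop :=
  exists (d : nat) (A : forall i, 'M[F]_(l i, d)),
    [/\ (0 < d)%N,
        forall i, (0 < l i <= d)%N,
        forall i, A i != 0
      & forall P, C P <-> zclosure (linmap_image idfun A) P].

(* Projection onto the factors sigma a, a : J. *)
Section Projection.
Variables (I J : finType) (sigma : J -> I) (l : I -> nat) (k : fieldType).

Definition proj_pullback (f : {mpoly k[nvars (l \o sigma)]}) :
    {mpoly k[nvars l]} :=
  mmap (@mpolyC (nvars l) k)
       (fun w => let s : {a : J & 'I_(l (sigma a))} := enum_val w in
                 'X_(@cvar I l (sigma (tag s)) (tagged s))) f.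

(* For integral closed subschemes C, D: the projection sends the generic      *)
(* point of C to that of D, and the induced embedding of the function field   *)
(* of D into that of C is onto. Function fields consist of the fractions      *)
(* f / g with f, g multihomogeneous of the same multidegree and g nonzero at  *)
(* the generic point.                                                         *)
Definition projects_birationally (C : pt l k -> Prop)
    (D : pt (l \o sigma) k -> Prop) : Prop :=
  exists eta theta,
    [/\ generic_point C eta,
        generic_point D theta,
        forall f, theta f <-> eta (proj_pullback f)
      & forall e f g, multihomog e f -> multihomog e g -> ~ eta g ->
          exists e' f' g', [/\ multihomog e' f', multihomog e' g', ~ theta g'
            & eta (f * proj_pullback g' - g * proj_pullback f')]].

End Projection.

(******************************************************************************)
(* Mustafin degenerations                                                     *)
(******************************************************************************)

Section Mustafin.
Variables (K : fieldType) (v : discrete_valuation K) (k : fieldType).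
Variables (pi : {rmorphism integers v -> k}) (V : vectType K).

Definition ranks (I : finType) (Gamma : I -> quotLattice v V) : I -> nat :=
  fun i => qlrank (Gamma i).

Definition mustafin (I : finType) (Gamma : I -> quotLattice v V) :
    pt (ranks Gamma) (integers v) -> Prop :=
  zclosure (linmap_image (@integer_val K v) (fun i => qlmx (Gamma i))).

(* a point of the product over k lies on the special fibre when its image in  *)
(* the product over the integers lies on the degeneration                     *)
Definition special_fibre (I : finType) (Gamma : I -> quotLattice v V)
    (P : pt (ranks Gamma) k) : Prop :=
  is_point P /\ @mustafin I Gamma (fun f => P (map_mpoly pi f)).

Definition component (I : finType) (Gamma : I -> quotLattice v V)
    (C : pt (ranks Gamma) k -> Prop) : Prop :=
  irreducible_component (@special_fibre I Gamma) C.

Definition primary_at (I : finType) (Gamma : I -> quotLattice v V) (i : I)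
    (C : pt (ranks Gamma) k -> Prop) : Prop :=
  component C /\
  projects_birationally C
    (@is_point unit (ranks Gamma \o (fun=> i)) k).

Definition primary (I : finType) (Gamma : I -> quotLattice v V)
    (C : pt (ranks Gamma) k -> Prop) : Prop :=
  exists i, primary_at i C.

Definition extend (I : finType) (Gamma : I -> quotLattice v V)
    (q : quotLattice v V) : option I -> quotLattice v V :=
  fun o => if o is Some i then Gamma i else q.

(* The class of q is taken outside of Gamma: otherwise adjoining it does not  *)
(* change the degeneration, and C would be primary.                           *)
Definition secondary (I : finType) (Gamma : I -> quotLattice v V)
    (C : pt (ranks Gamma) k -> Prop) : Prop :=
  [/\ component C,
      ~ primary C
    & exists2 q : quotLattice v V, (forall i, ~ homothetic (Gamma i) q) &
      exists D : pt (ranks (extend Gamma q)) k -> Prop,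
        primary_at None D /\
        @projects_birationally (option I) I Some _ k D C].

End Mustafin.

(* Main.v *)
Require Import Defs.
From HB Require Import structures.
From mathcomp Require Import all_boot all_order all_algebra.
From mathcomp Require Import ring_quotient generic_quotient mpoly.
From mathcomp Require Import boolp ring.
From mathcomp Require classical_sets.
Set Implicit Arguments.
Unset Strict Implicit.
Unset Printing Implicit Defensive.
Import Order.TTheory GRing.Theory Num.Theory.
Local Open Scope ring_scope.

(* Let eta be the generic point of a component C of the special fibre that is *)
(* birational to the i-th factor, and let A j be the matrix of V -> V/<M_j>.  *)
(* If A j factors through A i as A j = c B A i, with B integral and nonzero   *)
(* modulo the maximal ideal, then the j-th coordinates are proportional to    *)
(* B x_i on the whole degeneration, so on C they are given by the reduction   *)
(* of B; the same is trivially true when the j-th factor is a point. Hence C  *)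
(* is the multi-view variety of these reductions as soon as every A j with at *)
(* least two rows factors through A i.                                        *)
(* For this, dimension theory is replaced by a valuation argument. A place    *)
(* centred at eta exists by Chevalley's theorem; if some A j did not factor,  *)
(* moving the generic point of P(V) along a line contracted by A i would give *)
(* a larger irreducible subset of the special fibre containing C.             *)
(* A secondary component is the image of a primary component of a larger      *)
(* degeneration, so it is the multi-view variety of a subfamily of matrices.  *)

(** * Prime ideals as kernels *)

(** Everything is phrased with multihomogeneous prime ideals. The degeneration is the zero set of
    [multiker], the ideal of the generic image point ([linmap_closureP]), and a component is the
    zero set of its generic point [eta], which is minimal among the points of the special fibre
    below it ([component_generic]). So it suffices to show that [eta] is the [multiker] of a family
    of nonzero matrices over [k]. For a component birational to the i-th factor, [component_factors]
    shows that every matrix with at least two rows factors through the i-th one. Its proof combines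
    a place centred at [eta] ([dominating_place]) with a one-parameter deformation
    ([critical_line]). Scaling each factor matrix by an entry of least valuation and reducing it
    gives the matrices over [k] ([residue_matrix]), and the resulting minors determine [eta] because
    the i-th coordinates are independent on the component ([component_kernel]). A secondary
    component has as generic point the contraction of that of a primary component for one more
    lattice; contraction keeps a subfamily of the matrices ([hker_pullback]). *)

Record prime_ideal (R : comNzRingType) (P : R -> Prop) : Prop := PrimeIdeal {
  prime_ideal0 : P 0;
  prime_idealD : forall x y, P x -> P y -> P (x + y);
  prime_idealM : forall x y, P x -> P (y * x);
  prime_ideal1 : ~ P 1;
  prime_idealP : forall x y, P (x * y) -> P x \/ P y
}.

Section InverseChoice.
Variable Q : comNzRingType.

Definition has_inverse : {pred Q} := fun x => `[< exists y, y * x == 1 >].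

Definition chosen_inverse (x : Q) : Q :=
  if pselect (exists y, y * x == 1) is left e then xchoose e else x.

Fact chosen_inverseP : {in has_inverse, left_inverse 1 chosen_inverse *%R}.
Proof.
move=> x /asboolP e; rewrite /chosen_inverse.
by case: pselect => // e'; apply/eqP/(xchooseP e').
Qed.

Fact has_inverseP (x y : Q) : y * x = 1 -> has_inverse x.
Proof. by move=> yx; apply/asboolP; exists y; apply/eqP. Qed.

Fact chosen_inverse_out : {in [predC has_inverse], chosen_inverse =1 id}.
Proof.
move=> x; rewrite !inE => /asboolPn nx.
by rewrite /chosen_inverse; case: pselect.
Qed.

(** A ring without zero divisors only lacks an inverse operation to be an [idomainType]; classical
    choice supplies one, and [f] is the identity map. *)
Lemma idomain_embedding : (forall x y : Q, x * y = 0 -> (x == 0) || (y == 0)) ->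
  exists (D : idomainType) (f : {rmorphism Q -> D}), injective f.
Proof.
move=> ax.
pose U : comUnitRingType := HB.pack (GRing.ComNzRing.sort Q)
  (GRing.ComNzRing_hasMulInverse.Build Q chosen_inverseP has_inverseP
     chosen_inverse_out).
pose D : idomainType := HB.pack (GRing.ComUnitRing.sort U)
  (GRing.ComUnitRing_isIntegral.Build U ax).
have f0 : zmod_morphism (id : Q -> D) by [].
have f1 : monoid_morphism (id : Q -> D) by [].
pose f : {rmorphism Q -> D} := HB.pack (id : Q -> D)
  (GRing.isZmodMorphism.Build Q D id f0) (GRing.isMonoidMorphism.Build Q D id f1).
by exists D, f.
Qed.

End InverseChoice.

Section PrimeQuotient.
Variables (R : comNzRingType) (P : R -> Prop).

Definition prime_ideal_mem (PP : prime_ideal P) : R -> bool := fun x => `[< P x >].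

Fact prime_ideal_mem_closed (PP : prime_ideal P) :
  idealr_closed (prime_ideal_mem PP).
Proof.
split=> [||a x y]; rewrite !unfold_in /prime_ideal_mem.
- by apply/asboolP; exact: prime_ideal0 PP.
- by apply/asboolPn; exact: prime_ideal1 PP.
- move=> /asboolP Px /asboolP Py; apply/asboolP.
  by apply: (prime_idealD PP) => //; apply: (prime_idealM PP).
Qed.

HB.instance Definition _ (PP : prime_ideal P) :=
  isIdealr.Build R (prime_ideal_mem PP) (prime_ideal_mem_closed PP).

Lemma prime_ideal_kernel : prime_ideal P ->
  exists (D : idomainType) (f : {rmorphism R -> D}), forall x, f x = 0 <-> P x.
Proof.
move=> PP; pose I : idealr R := prime_ideal_mem PP.
pose p : {rmorphism R -> {ideal_quot I}} := \pi_({ideal_quot I})%qT.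
have pE x : p x = 0 <-> P x.
  rewrite -[0](rmorph0 p); split=> [/eqP|Px].
    by rewrite /p /= -Quotient.idealrBE subr0 => /asboolP.
  by apply/eqP; rewrite /p /= -Quotient.idealrBE subr0; apply/asboolP.
have [x y|D [f finj]] := @idomain_embedding {ideal_quot I}.
  rewrite -[x]reprK -[y]reprK => /eqP; rewrite -[_ * _](rmorphM p) => /eqP/pE.
  case/(prime_idealP PP)=> /pE /= ->; rewrite eqxx ?orbT //.
exists D, (f \o p) => x /=; rewrite -pE; split=> [|->]; last exact: rmorph0.
by move/eqP; rewrite raddf_eq0 // => /eqP.
Qed.

End PrimeQuotient.

(** * Chevalley's extension theorem *)

Section DominatingPairs.
Variables (R : comNzRingType) (F : fieldType) (phi : {rmorphism R -> F}).
Variables (P : R -> Prop) (PP : prime_ideal P).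
Hypothesis kerP : forall r, phi r = 0 -> P r.

(* A subring [dpA] containing the image of [phi], with an ideal [dpI] lying   *)
(* over [P]. Carrying the ideal along makes unions of chains immediate.       *)
Record dom_pair := DomPair {
  dpA : F -> Prop;
  dpI : F -> Prop;
  dpA_phi : forall r, dpA (phi r);
  dpAD : forall x y, dpA x -> dpA y -> dpA (x + y);
  dpAM : forall x y, dpA x -> dpA y -> dpA (x * y);
  dpIA : forall x, dpI x -> dpA x;
  dpID : forall x y, dpI x -> dpI y -> dpI (x + y);
  dpIM : forall a x, dpA a -> dpI x -> dpI (a * x);
  dpI_phi : forall r, P r -> dpI (phi r);
  dpI_contr : forall r, dpI (phi r) -> P r
}.

Definition dom_le (u w : dom_pair) : bool :=
  `[< (forall x, dpA u x -> dpA w x) /\ (forall x, dpI u x -> dpI w x) >].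

(** The starting point for Zorn's lemma, also bounding the empty chain. Since the kernel of [phi]
    lies in [P], the image of [P] contracts back to [P]. *)
Definition image_pair : dom_pair.
Proof.
refine (@DomPair (fun x => exists r, x = phi r)
  (fun x => exists2 r, P r & x = phi r) _ _ _ _ _ _ _ _).
- by move=> r; exists r.
- by move=> _ _ [r ->] [s ->]; exists (r + s); rewrite rmorphD.
- by move=> _ _ [r ->] [s ->]; exists (r * s); rewrite rmorphM.
- by move=> _ [r _ ->]; exists r.
- move=> _ _ [r Pr ->] [s Ps ->]; exists (r + s); last by rewrite rmorphD.
  exact: (prime_idealD PP).
- move=> _ _ [r ->] [s Ps ->]; exists (r * s); last by rewrite rmorphM.
  exact: (prime_idealM PP).
- by move=> r Pr; exists r.
- move=> r [s Ps e]; rewrite -(subrK s r); apply: (prime_idealD PP) => //.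
  by apply: kerP; rewrite rmorphB e subrr.
Defined.

Lemma dom_pair_maximal : exists u, classical_sets.premaximal dom_le u.
Proof.
apply: (classical_sets.ZL_preorder image_pair).
- by move=> u; apply/asboolP.
- move=> r s t /asboolP[A1 I1] /asboolP[A2 I2]; apply/asboolP.
  by split=> x /[dup]; [move/A1/A2|move/I1/I2].
move=> C Ctot; have [[u0 Cu0]|C0] := pselect (exists u, C u); last first.
  by exists image_pair => s Cs; case: C0; exists s.
have both u w : C u -> C w ->
    exists2 t, C t & (forall x, dpA u x \/ dpA w x -> dpA t x) /\
                     (forall x, dpI u x \/ dpI w x -> dpI t x).
  move=> Cu Cw; case: (Ctot u w Cu Cw) => /asboolP[hA hI].
    by exists w => //; split=> x [|//]; [exact: hA|exact: hI].
  by exists u => //; split=> x [//|]; [exact: hA|exact: hI].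
unshelve eexists.
  refine (@DomPair (fun x => exists2 u, C u & dpA u x)
    (fun x => exists2 u, C u & dpI u x) _ _ _ _ _ _ _ _).
  - by move=> r; exists u0 => //; exact: dpA_phi.
  - move=> x y [u Cu ux] [w Cw wy]; have [t Ct [hA _]] := both u w Cu Cw.
    by exists t => //; apply: dpAD; apply: hA; [left|right].
  - move=> x y [u Cu ux] [w Cw wy]; have [t Ct [hA _]] := both u w Cu Cw.
    by exists t => //; apply: dpAM; apply: hA; [left|right].
  - by move=> x [u Cu ux]; exists u => //; exact: dpIA.
  - move=> x y [u Cu ux] [w Cw wy]; have [t Ct [_ hI]] := both u w Cu Cw.
    by exists t => //; apply: dpID; apply: hI; [left|right].
  - move=> x y [u Cu ux] [w Cw wy]; have [t Ct [hA hI]] := both u w Cu Cw.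
    by exists t => //; apply: dpIM; [apply: hA; left|apply: hI; right].
  - by move=> r Pr; exists u0 => //; exact: dpI_phi.
  - by move=> r [u _ ur]; exact: dpI_contr ur.
by move=> s Cs; apply/asboolP; split=> x sx; exists s.
Qed.

Section Adjoin.
Variable u : dom_pair.

Lemma dpA0 : dpA u 0. Proof. by rewrite -(rmorph0 phi); exact: dpA_phi. Qed.
Lemma dpA1 : dpA u 1. Proof. by rewrite -(rmorph1 phi); exact: dpA_phi. Qed.
Lemma dpAN x : dpA u x -> dpA u (- x).
Proof.
by move=> ux; rewrite -mulN1r -(rmorphN1 phi); apply: dpAM => //; exact: dpA_phi.
Qed.
Lemma dpI0 : dpI u 0.
Proof. by rewrite -(rmorph0 phi); apply: dpI_phi; exact: (prime_ideal0 PP). Qed.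
Lemma dpIMr a x : dpA u a -> dpI u x -> dpI u (x * a).
Proof. by rewrite mulrC; exact: dpIM. Qed.
Lemma dpA_sum n (f : 'I_n -> F) : (forall i, dpA u (f i)) -> dpA u (\sum_i f i).
Proof.
by move=> uf; elim/big_ind: _ => //; [exact: dpA0|exact: dpAD].
Qed.

Lemma dpI_sum n (f : 'I_n -> F) : (forall i, dpI u (f i)) -> dpI u (\sum_i f i).
Proof.
by move=> uf; elim/big_ind: _ => //; [exact: dpI0|exact: dpID].
Qed.

(** Adjoin [x] to both the ring and the ideal. Only [dpI_contr] can fail for the enlarged pair, and
    its failure is exactly a relation of the second kind; if it holds, maximality puts [x] in the
    ring. *)
Lemma dpA_premaximal x : classical_sets.premaximal dom_le u ->
  dpA u x \/ exists s (q : {poly F}), [/\ ~ P s, forall i, dpI u q`_i & phi s = q.[x]].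
Proof.
move=> umax; set meets := (X in _ \/ X).
have [|nmeets] := pselect meets; first by right.
left; unshelve epose (w := _ : dom_pair).
  refine (@DomPair (fun y => exists2 q : {poly F}, forall i, dpA u q`_i & y = q.[x])
    (fun y => exists2 q : {poly F}, forall i, dpI u q`_i & y = q.[x])
    _ _ _ _ _ _ _ _).
  - move=> r; exists (phi r)%:P; last by rewrite hornerC.
    by move=> i; rewrite coefC; case: eqP => _; [exact: dpA_phi|exact: dpA0].
  - move=> _ _ [q uq ->] [q' uq' ->]; exists (q + q'); last by rewrite hornerD.
    by move=> i; rewrite coefD; apply: dpAD.
  - move=> _ _ [q uq ->] [q' uq' ->]; exists (q * q'); last by rewrite hornerM.
    by move=> i; rewrite coefM; apply: dpA_sum => j; apply: dpAM.
  - by move=> _ [q uq ->]; exists q => // i; apply: dpIA.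
  - move=> _ _ [q uq ->] [q' uq' ->]; exists (q + q'); last by rewrite hornerD.
    by move=> i; rewrite coefD; apply: dpID.
  - move=> _ _ [q uq ->] [q' uq' ->]; exists (q * q'); last by rewrite hornerM.
    by move=> i; rewrite coefM; apply: dpI_sum => j; apply: dpIM.
  - move=> r Pr; exists (phi r)%:P; last by rewrite hornerC.
    by move=> i; rewrite coefC; case: eqP => _; [exact: dpI_phi|exact: dpI0].
  - move=> s [q uq sq]; have [//|nPs] := pselect (P s).
    by case: nmeets; exists s, q.
have /umax/asboolP[wu _] : dom_le u w.
  apply/asboolP; split=> y uy; exists y%:P; rewrite ?hornerC // => i;
    by rewrite coefC; case: eqP => _ //; first [exact: dpA0|exact: dpI0].
apply: wu; exists 'X; last by rewrite hornerX.
by move=> i; rewrite coefX; case: eqP => _; [exact: dpA1|exact: dpA0].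
Qed.

(* The classical exchange argument: of the two relations the longer one can   *)
(* be shortened by means of the other one.                                    *)
Lemma dpI_no_two_relations x (q q' : {poly F}) s s' : x != 0 -> ~ P s -> ~ P s' ->
  (forall i, dpI u q`_i) -> (forall i, dpI u q'`_i) ->
  phi s = q.[x] -> phi s' = q'.[x^-1] -> False.
Proof.
have [N] := ubnP (size q + size q')%N.
elim: N x q q' s s' => // N IH x q q' s s' szN x0 nPs nPs' Iq Iq' sq sq'.
wlog le_q'q : x q q' s s' szN x0 nPs nPs' Iq Iq' sq sq' / (size q' <= size q)%N.
  move=> H; have /orP[] := leq_total (size q') (size q); first exact: H sq sq'.
  by apply: (H x^-1 q' q s' s); rewrite 1?addnC ?invr_eq0 ?invrK.
have [szq|szq] := leqP (size q) 1.
  apply: nPs; apply: (@dpI_contr u); rewrite sq (size1_polyC szq) hornerC.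
  exact: Iq.
set n := (size q).-1; have n_gt0 : (0 < n)%N by rewrite /n; case: (size q) szq => [|[]].
have szqE : size q = n.+1 by rewrite /n prednK // (ltn_trans _ szq).
pose b0 := q'`_0.
(* Multiplying the relation for the inverse of [x] by [x ^+ n] expresses [(phi s' - b0) * x ^+ n] by
   lower powers of [x]. *)
pose r := \poly_(j < n) q'`_(n - j)%N.
have rE : r.[x] = (phi s' - b0) * x ^+ n.
  rewrite sq' (@horner_coef_wide _ n.+1 q'); last by rewrite -szqE.
  rewrite big_ord_recl expr0 mulr1.
  rewrite -/b0 [b0 + _]addrC addrK mulr_suml.
  rewrite (@horner_coef_wide _ n) ?size_poly // (reindex_inj rev_ord_inj) /=.
  apply: eq_bigr => i _; rewrite coef_poly ltn_subrL n_gt0 /= subKn //.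
  rewrite -mulrA exprVn; congr (_ * _).
  apply: (mulfI (expf_neq0 i.+1 x0)).
  by rewrite -exprD subnKC // mulrA mulfV ?mul1r ?expf_neq0.
(* Multiply the relation for [s] by [phi s' - b0], replace its leading term by means of [r], and add
   [b0 * phi s] back: the value is [phi (s * s')] and the degree has dropped. *)
pose q2 := (b0 * phi s)%:P + (phi s' - b0) *: take_poly n q + q`_n *: r.
have q2E : phi (s * s') = q2.[x].
  have qE : q.[x] = (take_poly n q).[x] + q`_n * x ^+ n.
    rewrite (@horner_coef_wide _ n.+1) ?szqE // big_ord_recr /=; congr (_ + _).
    rewrite (@horner_coef_wide _ n) ?size_take_poly //.
    by apply: eq_bigr => i _; rewrite coef_take_poly ltn_ord.
  rewrite rmorphM !hornerE rE mulrCA -addrA -mulrDr -qE -sq.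
  by rewrite -mulrDl addrC subrK mulrC.
have Iq2 i : dpI u q2`_i.
  rewrite !coefD coefC !coefZ coef_take_poly coef_poly; apply: dpID; first apply: dpID.
  - case: eqP => _; last exact: dpI0.
    by apply: dpIMr; [exact: dpA_phi|exact: Iq'].
  - apply: dpIM; last by case: ifP => _ //; exact: dpI0.
    by apply: dpAD; [exact: dpA_phi|apply/dpAN/dpIA/Iq'].
  - apply: dpIM; first exact/dpIA/Iq.
    by case: ifP => _ //; exact: dpI0.
have szq2 : (size q2 <= n)%N.
  rewrite (leq_trans (size_polyD _ _)) // geq_max; apply/andP; split.
    rewrite (leq_trans (size_polyD _ _)) // geq_max (leq_trans (size_polyC_leq1 _)) //.
    by rewrite (leq_trans (size_scale_leq _ _)) // size_take_poly.
  by rewrite (leq_trans (size_scale_leq _ _)) // size_poly.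
apply: (IH x q2 q' (s * s') s' _ x0) => //.
  by rewrite -ltnS (leq_trans _ szN) // szqE ltnS addSn ltnS leq_add2r.
by case/(prime_idealP PP).
Qed.

Lemma dpA_valuation x : classical_sets.premaximal dom_le u ->
  x != 0 -> dpA u x \/ dpA u x^-1.
Proof.
move=> umax x0; case: (dpA_premaximal x umax) => [|[s [q [nPs Iq sq]]]]; first by left.
case: (dpA_premaximal x^-1 umax) => [|[s' [q' [nPs' Iq' sq']]]]; first by right.
by case: (dpI_no_two_relations x0 nPs nPs' Iq Iq' sq sq').
Qed.

(** Otherwise some [phi s'] with [s'] outside [P] is a polynomial in the inverse of [phi s] with
    coefficients in the ideal; clearing denominators puts [s'] times a power of [s] in [P]. *)
Lemma dpA_phiV s : classical_sets.premaximal dom_le u -> ~ P s -> dpA u (phi s)^-1.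
Proof.
move=> umax nPs; case: (dpA_premaximal (phi s)^-1 umax) => // -[s' [q [nPs' Iq sq]]].
have s0 : phi s != 0 by apply/eqP=> /kerP.
have : P (s' * s ^+ size q).
  apply: (@dpI_contr u); rewrite rmorphM rmorphXn sq horner_coef mulr_suml.
  apply: dpI_sum => i; rewrite -mulrA; apply: dpIMr => //.
  suff -> : (phi s)^-1 ^+ i * phi s ^+ size q = phi (s ^+ (size q - i)).
    exact: dpA_phi.
  rewrite rmorphXn exprVn; apply: (mulfI (expf_neq0 i s0)).
  by rewrite -exprD subnKC ?mulrA ?mulfV ?mul1r ?expf_neq0 // ltnW.
case/(prime_idealP PP) => //; elim: (size q) => [|n IH]; first by move/(prime_ideal1 PP).
by rewrite exprS => /(prime_idealP PP)[].
Qed.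

End Adjoin.
End DominatingPairs.

Record subring_mem (F : fieldType) := SubringMem {
  subring_mem_pred :> F -> bool;
  subring_memP : subring_closed subring_mem_pred
}.

HB.instance Definition _ (F : fieldType) (S : subring_mem F) :=
  GRing.isSubringClosed.Build F (subring_mem_pred S) (subring_memP S).

Record subring_type (F : fieldType) (S : subring_mem F) := SubringElt {
  subring_val :> F;
  subring_valP : subring_val \in subring_mem_pred S
}.

HB.instance Definition _ (F : fieldType) (S : subring_mem F) :=
  [isSub for @subring_val F S].
HB.instance Definition _ (F : fieldType) (S : subring_mem F) :=
  [Choice of subring_type S by <:].
HB.instance Definition _ (F : fieldType) (S : subring_mem F) :=
  [SubChoice_isSubComNzRing of subring_type S by <:].
HB.instance Definition _ (F : fieldType) (S : subring_mem F) :=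
  GRing.RMorphism.copy (@subring_val F S) (val : subring_type S -> F).

Lemma subring_lift (R : comNzRingType) (F : fieldType) (phi : {rmorphism R -> F})
    (S : subring_mem F) : (forall r, phi r \in subring_mem_pred S) ->
  exists psi : {rmorphism R -> subring_type S}, forall r, val (psi r) = phi r.
Proof.
move=> phiS; pose psi r : subring_type S := SubringElt (phiS r).
have psi0 : zmod_morphism psi by move=> x y; apply: val_inj; rewrite /= rmorphB.
have psi1 : monoid_morphism psi.
  by split=> [|x y]; apply: val_inj; rewrite /= ?rmorph1 ?rmorphM.
pose f : {rmorphism R -> subring_type S} := HB.pack psi
  (GRing.isZmodMorphism.Build R (subring_type S) psi psi0)
  (GRing.isMonoidMorphism.Build R (subring_type S) psi psi1).
by exists f.
Qed.

(* Here [T] is a valuation ring of [F] and [res] the corresponding place. *)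
Theorem dominating_place (R : comNzRingType) (F : fieldType)
    (phi : {rmorphism R -> F}) (P : R -> Prop) :
    prime_ideal P -> (forall r, phi r = 0 -> P r) ->
  exists (T : comNzRingType) (inc : {rmorphism T -> F}) (kappa : idomainType)
      (res : {rmorphism T -> kappa}) (psi : {rmorphism R -> T}),
    [/\ injective inc,
        forall x, (exists y, inc y = x) \/ (exists2 y, inc y = x^-1 & res y = 0),
        forall r, inc (psi r) = phi r
      & forall r, res (psi r) = 0 <-> P r].
Proof.
move=> PP kerP; have [u umax] := dom_pair_maximal PP kerP.
pose mem x := `[< dpA u x >].
have memP : subring_closed mem.
  split=> [|x y|x y]; rewrite !unfold_in /mem.
  - by apply/asboolP; exact: dpA1.
  - by move=> /asboolP ux /asboolP uy; apply/asboolP/dpAD => //; exact: dpAN.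
  - by move=> /asboolP ux /asboolP uy; apply/asboolP/dpAM.
pose S := SubringMem memP; pose T : comNzRingType := subring_type S.
pose inc : {rmorphism T -> F} := @subring_val F S.
have incP (y : T) : dpA u (inc y) by apply/asboolP; exact: (subring_valP y).
have incE x : dpA u x -> exists y : T, inc y = x.
  by move=> /asboolP ux; exists (SubringElt (ux : x \in subring_mem_pred S)).
have inc_inj : injective inc by exact: val_inj.
(* [M] consists of the non-units. It is closed under addition because of two nonzero elements one
   divides the other. *)
pose M (y : T) := inc y = 0 \/ ~ dpA u (inc y)^-1.
have PM : prime_ideal M.
  have MM (x y : T) : M x -> M (y * x).
    rewrite /M rmorphM; case=> [->|nx]; first by left; rewrite mulr0.
    have [->|x0] := eqVneq (inc x) 0; first by left; rewrite mulr0.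
    have [->|y0] := eqVneq (inc y) 0; first by left; rewrite mul0r.
    right=> uxy; apply: nx.
    by rewrite -[(inc x)^-1](mulVKf y0) -invfM mulrC; apply: dpAM.
  split=> [|x y Mx My|//||x y].
  - by left; rewrite rmorph0.
  - have [x0|x0] := eqVneq (inc x) 0.
      by rewrite (_ : x = 0) ?add0r //; apply: inc_inj; rewrite rmorph0.
    have [y0|y0] := eqVneq (inc y) 0.
      by rewrite (_ : y = 0) ?addr0 //; apply: inc_inj; rewrite rmorph0.
    wlog: x y Mx My x0 y0 / dpA u (inc x / inc y).
      have xy0 : inc x / inc y != 0 by rewrite mulf_neq0 ?invr_eq0.
      move=> H; case: (dpA_valuation PP umax xy0); first exact: H.
      by rewrite invf_div addrC; apply: H.
    case/incE=> t tE; suff -> : x + y = (t + 1) * y by exact: MM.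
    by apply: inc_inj; rewrite rmorphM !rmorphD rmorph1 tE mulrDl divfK // mul1r.
  - by case; rewrite rmorph1; [move/eqP; rewrite oner_eq0|rewrite invr1; case; exact: dpA1].
  - have [Mx|nMx] := pselect (M x); first by left.
    have [My|nMy] := pselect (M y); first by right.
    have unit z : ~ M z -> inc z <> 0 /\ dpA u (inc z)^-1.
      by move=> nMz; split=> [z0|]; [apply: nMz; left|apply: contrapT => ?; apply: nMz; right].
    have [[x0 ux] [y0 uy]] := (unit x nMx, unit y nMy).
    case; rewrite rmorphM; first by move/eqP; rewrite mulf_eq0 => /orP[/eqP|/eqP].
    by rewrite invfM; case; apply: dpAM.
have [kappa [res resE]] := prime_ideal_kernel PM.
have [|psi psiE] := @subring_lift R F phi S; first by move=> r; apply/asboolP/dpA_phi.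
exists T, inc, kappa, res, psi; split => // [x|r].
  have [->|x0] := eqVneq x 0; first by left; exists 0; rewrite rmorph0.
  have [/incE|nux] := pselect (dpA u x); [by left|right].
  have [//|/incE[y yE]] := dpA_valuation PP umax x0.
  by exists y => //; apply/resE; right; rewrite yE invrK.
have psiE' : inc (psi r) = phi r by exact: psiE.
rewrite resE /M psiE'; split=> [[|nur]|Pr]; first exact: kerP.
  by apply: contrapT => nPr; apply: nur; exact: (dpA_phiV PP kerP).
have [|r0] := eqVneq (phi r) 0; [by left|right=> ur].
apply: (prime_ideal1 PP); apply: (@dpI_contr _ _ _ _ u); rewrite rmorph1 -(mulVf r0).
by apply: dpIM => //; exact: dpI_phi.
Qed.

(** * Evaluation of multihomogeneous polynomials *)

Section Multicomp.
Variables (I : finType) (l : I -> nat) (R : comNzRingType).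
Implicit Types (f g : {mpoly R[nvars l]}) (e : {ffun I -> nat}).

Lemma mcoeff_multicomp e f m :
  (multicomp e f)@_m = if multideg m == e then f@_m else 0.
Proof.
rewrite /multicomp raddf_sum /=.
under eq_bigr do rewrite mcoeffZ mcoeffX.
have [fm|fm] := boolP (m \in msupp f); last first.
  rewrite (memN_msupp_eq0 fm) if_same big_seq_cond big1 // => m' /andP[m'f _].
  by case: eqP fm m'f => [->|_ _ _]; [move=> /negPf->|rewrite mulr0].
rewrite big_mkcond (bigD1_seq m) //= eqxx mulr1 big1 ?addr0 // => m' /negPf nm.
by rewrite nm mulr0 if_same.
Qed.

Lemma multihomog_multicomp e f : multihomog e (multicomp e f).
Proof.
move=> m; rewrite mcoeff_msupp mcoeff_multicomp.
by case: (multideg m =P e) => // _; rewrite eqxx.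
Qed.

Lemma multicompK e e' f :
  multicomp e' (multicomp e f) = if e' == e then multicomp e f else 0.
Proof.
apply/mpolyP => m; rewrite !mcoeff_multicomp (fun_if (mcoeff m)).
case: (eqVneq e' e) => [->|/negPf ne]; first by rewrite mcoeff_multicomp; case: eqP.
by rewrite mcoeff0; case: eqP => // ->; rewrite ne.
Qed.

Lemma multicomp_sum f :
  f = \sum_(e <- undup [seq multideg m | m <- msupp f]) multicomp e f.
Proof.
apply/mpolyP => m; rewrite raddf_sum /=.
under eq_bigr do rewrite mcoeff_multicomp.
have [fm|/memN_msupp_eq0->] := boolP (m \in msupp f); last first.
  by rewrite big1 // => e _; rewrite if_same.
rewrite (bigD1_seq (multideg m)) ?undup_uniq ?mem_undup ?map_f //= eqxx.
by rewrite big1 ?addr0 // => e; rewrite eq_sym => /negPf->.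
Qed.

Lemma point_sum (P : pt l R) (s : seq {ffun I -> nat}) (F : {ffun I -> nat} -> _) :
  is_point P -> (forall e, P (F e)) -> P (\sum_(e <- s) F e).
Proof. by move=> PP PF; elim/big_ind: _ => //; [exact: point0|exact: pointD]. Qed.

Lemma point_multicomp (P : pt l R) f :
  is_point P -> P f <-> forall e, P (multicomp e f).
Proof.
move=> PP; split=> [Pf e|Pf]; first exact: point_homog.
by rewrite (multicomp_sum f); apply: point_sum.
Qed.

Lemma prime_ideal_point (P : pt l R) : is_point P -> prime_ideal P.
Proof. by case=> P0 PD PM P1 Pprime _ _; exact: PrimeIdeal P0 PD PM P1 Pprime. Qed.

End Multicomp.

Lemma multicomp_map (I : finType) (l : I -> nat) (R S : comNzRingType)
    (p : {rmorphism R -> S}) e (f : {mpoly R[nvars l]}) :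
  multicomp e (map_mpoly p f) = map_mpoly p (multicomp e f).
Proof.
apply/mpolyP => m; rewrite mcoeff_map_mpoly !mcoeff_multicomp mcoeff_map_mpoly.
by case: (boolP (multideg m == e)) => // _; rewrite raddf0.
Qed.

Section Evaluation.
Variables (I : finType) (l : I -> nat).

Section Def.
Variables (R S : comNzRingType) (theta : {rmorphism R -> S}).

Definition ev (h : forall i, 'I_(l i) -> S) : {mpoly R[nvars l]} -> S :=
  mmap theta (fun w => h _ (tagged (enum_val w : {i : I & 'I_(l i)}))).

HB.instance Definition _ h := GRing.RMorphism.copy (ev h)
  (mmap theta (fun w => h _ (tagged (enum_val w : {i : I & 'I_(l i)})))).

Lemma evC h c : ev h c%:MP = theta c.
Proof. exact: mmapC. Qed.

Lemma ev_cvar (h : forall i, 'I_(l i) -> S) i (j : 'I_(l i)) : ev h 'X_(cvar j) = h i j.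
Proof. by rewrite /ev mmapX mmap1U enum_rankK. Qed.

Lemma evX (h : forall i, 'I_(l i) -> S) w :
  ev h 'X_w = h _ (tagged (enum_val w : {i : I & 'I_(l i)})).
Proof. by rewrite /ev mmapX mmap1U. Qed.

Lemma evZ h c f : ev h (c *: f) = theta c * ev h f.
Proof. exact: mmapZ. Qed.

Lemma eq_ev (h h' : forall i, 'I_(l i) -> S) f :
  (forall i j, h i j = h' i j) -> ev h f = ev h' f.
Proof. by move=> hh; apply: eq_bigr => m _; congr (_ * _); apply: mmap1_eq. Qed.

Lemma prod_tag (c : I -> S) (m : 'X_{1..nvars l}) :
  \prod_w c (tag (enum_val w : {i : I & 'I_(l i)})) ^+ m w =
  \prod_i c i ^+ multideg m i.
Proof.
rewrite (reindex _ (onW_bij _ (enum_rank_bij _))) /=.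
under eq_bigr do rewrite enum_rankK.
under [RHS]eq_bigr do rewrite ffunE -prodrXr.
rewrite (@sig_big_dep _ _ _ I (fun i => 'I_(l i)) predT (fun _ => predT)
  (fun i j => c i ^+ m (cvar j))).
by apply: eq_bigr => -[].
Qed.

Lemma ev_scale (c : I -> S) (h h' : forall i, 'I_(l i) -> S) e f :
    multihomog e f -> (forall i j, h' i j = c i * h i j) ->
  ev h' f = (\prod_i c i ^+ e i) * ev h f.
Proof.
move=> fe hh; rewrite /ev /mmap big_distrr big_seq [RHS]big_seq /=.
apply: eq_bigr => m /fe me; rewrite mulrCA; congr (_ * _).
rewrite -me -prod_tag /mmap1 -big_split /=.
by apply: eq_bigr => w _; rewrite hh exprMn.
Qed.

End Def.

Lemma ev_morph (R S S' : comNzRingType) (theta : {rmorphism R -> S})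
    (theta' : {rmorphism R -> S'}) (q : {rmorphism S -> S'})
    (h : forall i, 'I_(l i) -> S) h' f :
    (forall c, q (theta c) = theta' c) -> (forall i j, q (h i j) = h' i j) ->
  q (ev theta h f) = ev theta' h' f.
Proof.
move=> qtheta qh; rewrite /ev /mmap rmorph_sum; apply: eq_bigr => m _.
rewrite rmorphM qtheta rmorph_prod; congr (_ * _); apply: eq_bigr => w _.
by rewrite rmorphXn qh.
Qed.

Lemma ev_map (R R' S : comNzRingType) (p : {rmorphism R -> R'})
    (theta : {rmorphism R -> S}) (theta' : {rmorphism R' -> S})
    (h : forall i, 'I_(l i) -> S) f :
    (forall c, theta' (p c) = theta c) ->
  ev theta' h (map_mpoly p f) = ev theta h f.
Proof.
move=> pc; rewrite [in LHS]/map_mpoly [in X in ev _ _ X = _]/mmap rmorph_sum.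
rewrite [in RHS]/ev [in RHS]/mmap; apply: eq_bigr => m _.
rewrite rmorphM /= evC pc rmorph_prod; congr (_ * _); apply: eq_bigr => w _.
by rewrite rmorphXn /= evX.
Qed.

Section Generic.
Variables (R S : comNzRingType) (theta : {rmorphism R -> S}).
Variable h : forall i, 'I_(l i) -> S.

(* The generic point of the cone over the image: the i-th vector is scaled by *)
(* an independent variable, which separates the multidegrees.                 *)
Definition gev : {mpoly R[nvars l]} -> {mpoly S[#|I|]} :=
  ev (@mpolyC #|I| S \o theta) (fun i j => 'X_(enum_rank i) * (h j)%:MP).

HB.instance Definition _ := GRing.RMorphism.copy gev
  (ev (@mpolyC #|I| S \o theta) (fun i j => 'X_(enum_rank i) * (h j)%:MP)).

(** The largest multihomogeneous ideal on which evaluation at [h] vanishes, that is, the ideal of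
    the point with multiprojective coordinates [h]. *)
Definition hker (f : {mpoly R[nvars l]}) : Prop := forall e, ev theta h (multicomp e f) = 0.

Definition tmon (e : {ffun I -> nat}) : 'X_{1..#|I|} := [multinom e (enum_val i) | i < #|I|].

Lemma tmon_inj : injective tmon.
Proof.
move=> e e' /mnmP ee; apply/ffunP => i.
by have := ee (enum_rank i); rewrite !mnmE enum_rankK.
Qed.

Lemma tmon_onto m : exists e, m = tmon e.
Proof.
exists [ffun i => m (enum_rank i)]; apply/mnmP => i.
by rewrite mnmE ffunE enum_valK.
Qed.

Lemma gev_coeff e f : (gev f)@_(tmon e) = ev theta h (multicomp e f).
Proof.
rewrite /gev {1}/ev /mmap raddf_sum /multicomp raddf_sum [RHS]big_mkcond /=.
apply: eq_bigr => m _; rewrite evZ.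
rewrite (_ : mmap1 _ m = 'X_[tmon (multideg m)] *
    (mmap1 (fun w => h (tagged (enum_val w : {i : I & 'I_(l i)}))) m)%:MP); last first.
  rewrite [in RHS]rmorph_prod /=.
  rewrite (_ : 'X_[_] = \prod_w 'X_(enum_rank (tag (enum_val w : {i : I & 'I_(l i)}))) ^+ m w).
    by rewrite -big_split /=; apply: eq_bigr => w _; rewrite exprMn rmorphXn.
  rewrite (prod_tag (fun i => 'X_(enum_rank i))) mpolyXE_id.
  rewrite (reindex _ (onW_bij _ (enum_rank_bij _))).
  by apply: eq_bigr => i _; rewrite mnmE enum_rankK.
rewrite mulrCA -rmorphM mulrC mcoeffCM mcoeffX (inj_eq tmon_inj).
by case: eqP => _; rewrite ?mulr1 ?mulr0 // /ev mmapX.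
Qed.

Lemma hkerE f : hker f <-> gev f = 0.
Proof.
split=> [f0|f0 e]; last by rewrite -gev_coeff f0 mcoeff0.
by apply/mpolyP => m; have [e ->] := tmon_onto m; rewrite gev_coeff f0 mcoeff0.
Qed.

Lemma hker_ev f : hker f -> ev theta h f = 0.
Proof.
move=> f0; rewrite (multicomp_sum f) raddf_sum big1 // => e _; exact: f0.
Qed.

End Generic.

(** Primality holds because [hker] is the kernel of the ring morphism [gev] into a domain. *)
Lemma hker_point (R : comNzRingType) (S : idomainType) (theta : {rmorphism R -> S})
    (h : forall i, 'I_(l i) -> S) :
  (forall i, exists j, h i j != 0) -> is_point (hker theta h).
Proof.
move=> hN0; split.
- by rewrite hkerE rmorph0.
- by move=> f g; rewrite !hkerE rmorphD /= => -> ->; rewrite addr0.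
- by move=> f g; rewrite !hkerE rmorphM /= => ->; rewrite mulr0.
- by rewrite hkerE rmorph1; apply/eqP/oner_neq0.
- move=> f g; rewrite !hkerE rmorphM /= => /eqP.
  by rewrite mulf_eq0 => /orP[/eqP|/eqP]; [left|right].
- move=> f f0 e e'; rewrite multicompK; case: eqP => _; last exact: rmorph0.
  exact: f0.
- move=> i; have [j hj] := hN0 i; exists j; rewrite hkerE /gev ev_cvar.
  by apply/eqP; rewrite mulf_neq0 ?mpolyC_eq0 // -msupp_eq0 msuppX.
Qed.

End Evaluation.

(** * Images of linear rational maps *)

Lemma eq_pred (T : Type) (P Q : T -> Prop) : (forall x, P x <-> Q x) -> P = Q.
Proof. by move=> PQ; apply/funext => x; apply/propext. Qed.

Lemma zero_point (I : finType) (l : I -> nat) (R : idomainType) :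
  (forall i, 0 < l i)%N -> is_point (fun f : {mpoly R[nvars l]} => f = 0).
Proof.
move=> l_gt0; split=> [//|f g -> ->|f g ->||f g /eqP|f -> e|i].
- by rewrite addr0.
- by rewrite mulr0.
- by apply/eqP/oner_neq0.
- by rewrite mulf_eq0 => /orP[/eqP|/eqP]; [left|right].
- by apply/mpolyP => m; rewrite mcoeff_multicomp mcoeff0 if_same.
- by exists (Ordinal (l_gt0 i)); apply/eqP; rewrite -msupp_eq0 msuppX.
Qed.

Section LinearImage.
Variables (I : finType) (l : I -> nat) (R : comNzRingType) (F : fieldType).
Variables (iota : {rmorphism R -> F}) (d : nat) (A : forall i, 'M[F]_(l i, d)).

(** The image of the generic point of the source projective space: the coordinates are the linear
    forms themselves. *)
Definition multiker : pt l R :=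
  hker (@mpolyC (nvars (unit_dim d)) F \o iota) (@linform I l F d A).

Lemma linform_neq0 i j : row j (A i) != 0 -> linform A j != 0.
Proof.
apply: contraNneq => Aj0; apply/eqP/rowP => c; rewrite !mxE.
have := congr1 (mcoeff U_(@cvar _ (unit_dim d) tt c)) Aj0.
rewrite raddf_sum mcoeff0 (bigD1 c) //= mcoeffZ mcoeffX eqxx mulr1 big1 ?addr0 // => c' cc'.
rewrite mcoeffZ mcoeffX; case: eqP => [/mnmP/(_ (@cvar _ (unit_dim d) tt c))|];
  last by rewrite mulr0.
rewrite !mnm1E eqxx; case: eqP => // /enum_rank_inj /eqP.
by rewrite eq_Tagged /= (negPf cc').
Qed.

Lemma matrix_row_neq0 (m n : nat) (M : 'M[F]_(m, n)) : M != 0 -> exists j, row j M != 0.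
Proof.
move=> M0; apply/existsP; apply: contraNT M0 => /existsPn rM.
by apply/eqP/row_matrixP => j; rewrite row0; apply/eqP/negPn/rM.
Qed.

Lemma linmap_pt_point P : is_point P -> linmap_dom A P -> is_point (linmap_pt iota A P).
Proof.
move=> PP dom; have [D [q qE]] := prime_ideal_kernel (prime_ideal_point PP).
rewrite (_ : linmap_pt _ _ _ =
  hker (q \o (@mpolyC (nvars (unit_dim d)) F \o iota)) (fun i j => q (linform A j))).
  by apply: hker_point => i; have [j nP] := dom i; exists j; apply/eqP => /qE.
apply: eq_pred => f.
by split=> Pf e; have := Pf e; rewrite -qE /linsubst -(@ev_morph _ _ _ _ _
  (@mpolyC (nvars (unit_dim d)) F \o iota) _ q (@linform I l F d A)).
Qed.

Hypotheses (d_gt0 : (0 < d)%N) (A0 : forall i, A i != 0).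

Lemma multiker_image : linmap_image iota A multiker.
Proof.
exists (fun f => f = 0); split=> //; first exact: zero_point.
by move=> i; have [j /linform_neq0/eqP Aj] := matrix_row_neq0 (A0 i); exists j.
Qed.

(** [multiker] belongs to the image and is contained in every other point of it, so it alone
    determines the closure. *)
Lemma linmap_closureP Q : zclosure (linmap_image iota A) Q <->
  is_point Q /\ forall f, multiker f -> Q f.
Proof.
have ptI Q' : linmap_image iota A Q' -> is_point Q' /\ forall f, multiker f -> Q' f.
  case=> P [PP dom /eq_pred->]; split; first exact: linmap_pt_point.
  by move=> f f0 e; rewrite (f0 e : linsubst iota A (multicomp e f) = 0); exact: point0.
split=> [clQ|[PQ kQ] E /(_ _ multiker_image)[_ Ek]]; last by split=> // f /Ek/kQ.
by apply: (clQ multiker) => Q' /ptI.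
Qed.

End LinearImage.

Lemma rmorph_factor (R k S : comNzRingType) (p : {rmorphism R -> k})
    (g : {rmorphism R -> S}) :
    (forall a, exists x, p x = a) -> (forall x, p x = 0 -> g x = 0) ->
  exists theta : {rmorphism k -> S}, forall x, theta (p x) = g x.
Proof.
move=> p_onto kerp.
have ponto a : exists x, p x == a by have [x <-] := p_onto a; exists x.
pose theta a := g (xchoose (ponto a)).
have thetaE x : theta (p x) = g x.
  apply/eqP; rewrite -subr_eq0 -rmorphB; apply/eqP/kerp.
  by rewrite rmorphB (eqP (xchooseP (ponto (p x)))) subrr.
have theta0 : zmod_morphism theta.
  move=> a b; have [[x <-] [y <-]] := (p_onto a, p_onto b).
  by rewrite -rmorphB !thetaE rmorphB.
have theta1 : monoid_morphism theta.
  split=> [|a b]; first by rewrite -(rmorph1 p) thetaE rmorph1.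
  have [[x <-] [y <-]] := (p_onto a, p_onto b).
  by rewrite -rmorphM !thetaE rmorphM.
pose f : {rmorphism k -> S} := HB.pack theta
  (GRing.isZmodMorphism.Build k S theta theta0)
  (GRing.isMonoidMorphism.Build k S theta theta1).
by exists f.
Qed.

Lemma map_mpoly_onto n (R S : comNzRingType) (p : {rmorphism R -> S}) :
  (forall a, exists x, p x = a) ->
  forall f : {mpoly S[n]}, exists g : {mpoly R[n]}, map_mpoly p g = f.
Proof.
move=> p_onto f; elim/mpolyind: f => [|c m f _ _ [g <-]].
  by exists 0; rewrite rmorph0.
have [x <-] := p_onto c; exists (x *: 'X_[m] + g).
by rewrite rmorphD /= map_mpolyZ map_mpolyX.
Qed.

Lemma total_preorder_max (T : finType) (le : T -> T -> Prop) (x0 : T) :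
    (forall x y, le x y \/ le y x) ->
    (forall x y z, le x y -> le y z -> le x z) ->
  exists m, forall x, le x m.
Proof.
move=> tot tr; suff [m hm] : exists m, forall x, x \in enum T -> le x m.
  by exists m => x; apply: hm; rewrite mem_enum.
have refl x : le x x by case: (tot x x).
elim: (enum T) => [|y s [m hm]]; first by exists x0.
by case: (tot y m) => ym; [exists m|exists y] => x;
  rewrite inE => /orP[/eqP->|/hm] //; move=> xm; exact: tr xm ym.
Qed.

Lemma pullback_point (I : finType) (l : I -> nat) (R S : comNzRingType)
    (p : {rmorphism R -> S}) (P : pt l S) :
  is_point P -> is_point (fun f => P (map_mpoly p f)).
Proof.
move=> PP; split=> [|f g|f g||f g|f Pf e|i].
- by rewrite rmorph0; exact: point0.
- by rewrite rmorphD; exact: pointD.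
- by rewrite rmorphM; exact: pointM.
- by rewrite rmorph1; exact: point1.
- by rewrite rmorphM; exact: point_prime.
- by rewrite -multicomp_map; exact: point_homog.
- by have [j nP] := point_relevant PP i; exists j; rewrite map_mpolyX.
Qed.

Lemma fraction_field (D : idomainType) :
  exists (L : fieldType) (emb : {rmorphism D -> L}), injective emb.
Proof.
exists {fraction D}, (@tofrac D) => a b /eqP.
by rewrite -subr_eq0 -rmorphB tofrac_eq0 subr_eq0 => /eqP.
Qed.

(** Rescaling the vectors by independent variables and passing to fractions turns [hker] into the
    kernel of a single evaluation in a field, as [dominating_place] requires. *)
Lemma independent_scalars (I : finType) (l : I -> nat) (R : comNzRingType)
    (D : idomainType) (theta : {rmorphism R -> D}) (h : forall i, 'I_(l i) -> D) :
  exists (L : fieldType) (emb : {rmorphism D -> L}) (t : I -> L),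
  [/\ injective emb, forall i, t i != 0
    & forall f, ev (emb \o theta) (fun i j => t i * emb (h i j)) f = 0 -> hker theta h f].
Proof.
have [L [emb emb_inj]] := fraction_field {mpoly D[#|I|]}.
exists L, (emb \o @mpolyC #|I| D), (fun i => emb 'X_(enum_rank i)).
split; first by move=> a b /emb_inj /(congr1 (mcoeff 0)); rewrite !mcoeffC eqxx !mulr1.
  by move=> i; rewrite raddf_eq0 // -msupp_eq0 msuppX.
move=> f evf; apply/hkerE/emb_inj; rewrite rmorph0 -[RHS]evf.
by apply: ev_morph => // i j; rewrite rmorphM.
Qed.

Section LinearEvaluation.
Variables (I : finType) (l : I -> nat) (R : comNzRingType) (F : fieldType).
Variables (iota : {rmorphism R -> F}) (d : nat) (A : forall i, 'M[F]_(l i, d)).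

(** The equations of the image hold at every specialisation [y] of the generic vector, and
    multihomogeneity absorbs the scalars [c]. *)
Lemma multiker_eval (S : comNzRingType) (kappa : {rmorphism F -> S})
    (theta : {rmorphism R -> S}) (y : 'cV[S]_d) (c : I -> S)
    (h : forall i, 'I_(l i) -> S) f :
    (forall r, theta r = kappa (iota r)) ->
    (forall i j, h i j = c i * (map_mx kappa (A i) *m y) j 0) ->
  multiker iota A f -> hker theta h f.
Proof.
move=> thetaE hE f0 e; have fe : multihomog e (multicomp e f) by exact: multihomog_multicomp.
rewrite (@ev_scale _ _ _ _ theta c
  (fun i j => (map_mx kappa (A i) *m y) j 0) h _ _ fe) //.
pose q : {mpoly F[nvars (unit_dim d)]} -> S := ev kappa (fun _ c => y c 0).
rewrite -(@ev_morph _ _ _ _ _ (@mpolyC (nvars (unit_dim d)) F \o iota) _ q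
  (@linform I l F d A)); first by rewrite [ev _ _ _]f0 rmorph0 mulr0.
  by move=> r; rewrite thetaE [LHS]evC.
move=> i j; rewrite /linform rmorph_sum mxE; apply: eq_bigr => b _.
by rewrite [LHS]evZ ev_cvar mxE.
Qed.

(* x and t are independent variables. *)
Lemma generic_field : exists (L : fieldType) (kappa : {rmorphism F -> L})
    (x : 'cV[L]_d) (t : I -> L),
  [/\ forall i, t i != 0,
      forall M : 'rV[F]_d, map_mx kappa M *m x = 0 -> M = 0
    & forall f, ev (kappa \o iota)
        (fun i j => t i * (map_mx kappa (A i) *m x) j 0) f = 0 -> multiker iota A f].
Proof.
pose F0 : idomainType := {mpoly F[nvars (unit_dim d)]}.
pose inF0 : {rmorphism F -> F0} := @mpolyC (nvars (unit_dim d)) F.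
pose X : 'cV[F0]_d := \col_c 'X_(@cvar _ (unit_dim d) tt c).
have linE i j : (map_mx inF0 (A i) *m X) j 0 = linform A j.
  by rewrite mxE; apply: eq_bigr => c _; rewrite !mxE mul_mpolyC.
have X_indep (M : 'rV[F]_d) : map_mx inF0 M *m X = 0 -> M = 0.
  move=> /matrixP/(_ 0 0); rewrite [RHS]mxE => /eqP MX0.
  apply: contraTeq MX0 => M0; have := @linform_neq0 unit (fun=> 1%N) F d (fun=> M) tt 0.
  rewrite row_id => /(_ M0); congr (_ != 0); rewrite mxE.
  by apply: eq_bigr => c _; rewrite !mxE mul_mpolyC.
have mkE f : hker (inF0 \o iota) (fun i j => (map_mx inF0 (A i) *m X) j 0) f ->
    multiker iota A f.
  by move=> f0 e; rewrite -[RHS](f0 e); apply: eq_ev => i j; rewrite linE.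
clear linE; clearbody X inF0; move: F0 inF0 X X_indep mkE => D inD X X_indep mkE.
have [L [emb [t [emb_inj t0 tker]]]] := independent_scalars (inD \o iota)
  (fun i j => (map_mx inD (A i) *m X) j 0).
have embX m (M : 'M[F]_(m, d)) :
    map_mx (emb \o inD) M *m map_mx emb X = map_mx emb (map_mx inD M *m X).
  by rewrite map_mxM -map_mx_comp.
exists L, (emb \o inD), (map_mx emb X), t; split=> // [M|f f0].
  rewrite embX -(map_mx0 emb) => /matrixP MX0; apply/X_indep/matrixP => i j.
  by apply: emb_inj; have := MX0 i j; rewrite mxE [RHS]mxE.
apply/mkE/tker; rewrite -[RHS]f0; apply: eq_ev => i j.
by rewrite embX [in RHS]mxE.
Qed.

End LinearEvaluation.

(** * Degenerating along a line *)

Section CriticalLine.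
Variables (L : fieldType) (T : comNzRingType) (inc : {rmorphism T -> L}).
Variables (kappa : idomainType) (res : {rmorphism T -> kappa}).
Hypothesis inc_inj : injective inc.
Hypothesis inc_val :
  forall x, (exists y, inc y = x) \/ (exists2 y, inc y = x^-1 & res y = 0).

Lemma inc_eq0 y : inc y = 0 -> y = 0.
Proof. by rewrite -(rmorph0 inc) => /inc_inj. Qed.

Lemma place_unit y : res y != 0 -> inc y != 0 /\ exists y', inc y' = (inc y)^-1.
Proof.
move=> ry; split; first by apply: contraNneq ry => /inc_eq0 ->; rewrite rmorph0.
case: (inc_val (inc y)^-1) => // -[z]; rewrite invrK => /inc_inj -> rz.
by rewrite rz eqxx in ry.
Qed.

(** Divisibility over a valuation ring is a total preorder, so in a finite family an entry of least
    valuation divides all the others. *)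
Lemma place_preorder_max (X : finType) (x0 : X) (f : X -> L) :
  exists m, forall x, exists y, f x = inc y * f m.
Proof.
apply: (total_preorder_max (le := fun x y => exists z, f x = inc z * f y) x0).
  move=> x y; have [->|fy] := eqVneq (f y) 0.
    by right; exists 0; rewrite rmorph0 mul0r.
  have [->|fx] := eqVneq (f x) 0; first by left; exists 0; rewrite rmorph0 mul0r.
  case: (inc_val (f x / f y)) => [[z zE]|[z zE _]]; [left|right]; exists z.
    by rewrite zE divfK.
  by rewrite zE invf_div divfK.
move=> x y z [p ->] [q ->]; exists (p * q); by rewrite rmorphM mulrA.
Qed.

Variables (I : finType) (l : I -> nat).
Variables (W : forall i, 'I_(l i) -> T) (u : forall i, 'I_(l i) -> L).
Variable a : forall i, 'I_(l i).
Hypothesis Wa : forall i, res (W (a i)) != 0.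

(* Consider the lines s |-> [W i + s u i] in projective spaces. Replacing u   *)
(* by rho (u - c0 W) reparametrises all of them at once, fixing s = 0. It is  *)
(* chosen so that, after making the i-th line integral by the factor alpha i, *)
(* every reduction still passes through [res (W i)] at s = 0, while that of   *)
(* the j0-th line is not constant. When res (alpha i) = 0 the reduction is    *)
(* the constant [res (W i)], multiplied by s.                                 *)
Lemma critical_line j1 (b1 : 'I_(l j1)) :
    u b1 * inc (W (a j1)) != u (a j1) * inc (W b1) ->
  exists (rho c0 : L) (alpha beta : I -> T) (N : forall i, 'I_(l i) -> T)
      (j0 : I) (b0 : 'I_(l j0)),
  [/\ [/\ forall i, inc (alpha i) != 0,
      forall i, res (alpha i) = 1 \/ (res (alpha i) = 0 /\ res (beta i) = 1),
      forall i (b : 'I_(l i)), inc (alpha i) * (rho * (u b - c0 * inc (W b))) =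
        inc (beta i * W b + alpha i * N i b)
    & forall i, N i (a i) = 0],
    [/\ N j0 b0 = 1, res (alpha j0) = 1 & res (beta j0) = 0]
    & forall i, (forall b : 'I_(l i), u b = 0) -> forall b : 'I_(l i), N i b = 0].
Proof.
move=> nprop.
have Wa0 i : inc (W (a i)) != 0 by have [] := place_unit (Wa i).
(* Subtracting [c i] times [W] from the direction kills its coordinate [a i]; what is left, [nu], is
   the part that really moves the i-th projective point. *)
pose c i := u (a i) / inc (W (a i)).
pose nu i (b : 'I_(l i)) := u b - c i * inc (W b).
have nu1 : nu j1 b1 != 0.
  apply: contraNneq nprop => nu0; apply/eqP.
  by move/eqP: nu0; rewrite subr_eq0 => /eqP->; rewrite mulrAC divfK.
have [[j0 b0] nuN] := place_preorder_max (Tagged (fun i => 'I_(l i)) b1)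
  (fun s : {i : I & 'I_(l i)} => nu _ (tagged s)).
pose rho := (nu j0 b0)^-1.
have nu0 : nu j0 b0 != 0.
  have [y yE] := nuN (Tagged (fun i => 'I_(l i)) b1).
  by apply: contraNneq nu1 => n0; rewrite [nu _ _]yE /= n0 mulr0.
have nuN' i : exists f : 'I_(l i) -> T, forall b, inc (f b) = rho * nu i b.
  apply: (@fin_all_exists _ _ (fun b y => inc y = rho * nu i b)) => b.
  have [y yE] := nuN (Tagged (fun i => 'I_(l i)) b); exists y.
  by rewrite [nu _ _]yE /= mulrCA mulVf // mulr1.
have [N NE] := @fin_all_exists _ _ (fun i (f : 'I_(l i) -> T) =>
  forall b, inc (f b) = rho * nu i b) nuN'.
(* The ratio of [beta] to [alpha] must be [rho * (c i - c j0)]. If this is integral, take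
   [alpha = 1]; otherwise its inverse has residue zero and serves as [alpha], with [beta = 1]. *)
have abP i : exists ab : T * T, [/\ inc ab.1 != 0,
    res ab.1 = 1 \/ (res ab.1 = 0 /\ res ab.2 = 1)
    & inc ab.2 = inc ab.1 * (rho * (c i - c j0))].
  have [[y yE]|nT] := pselect (exists y, inc y = rho * (c i - c j0)).
    by exists (1, y); rewrite /= !rmorph1 oner_neq0 mul1r; split => //; left.
  case: (inc_val (rho * (c i - c j0))) => // -[y yE ry]; exists (y, 1) => /=.
  have r0 : rho * (c i - c j0) != 0.
    by apply/eqP => r0; apply: nT; exists 0; rewrite rmorph0 r0.
  by rewrite yE invr_eq0 !rmorph1 mulVf //; split=> //; right.
have [ab abE] := @fin_all_exists _ (fun=> (T * T)%type) _ abP.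
exists rho, (c j0), (fun i => (ab i).1), (fun i => (ab i).2), N, j0, b0.
split; [split|split|].
- by move=> i; have [] := abE i.
- by move=> i; have [] := abE i.
- move=> i b; have [_ _ bE] := abE i; rewrite rmorphD !rmorphM bE NE.
  by rewrite /nu; move: (c i) (c j0) => ? ?; ring.
- by move=> i; apply: inc_inj; rewrite NE /nu /c divfK // subrr mulr0 rmorph0.
- by apply: inc_inj; rewrite NE mulVf // rmorph1.
- have [_ _ bE] := abE j0; have b0E : (ab j0).2 = 0.
    by apply: inc_eq0; rewrite bE subrr !mulr0.
  have [_ [//|[_ b1E]] _] := abE j0; move: b1E.
  by rewrite b0E rmorph0 => e01; have := oner_neq0 kappa; rewrite -e01 eqxx.
- have [_ _ bE] := abE j0; rewrite (inc_eq0 (y := (ab j0).2)) ?rmorph0 //.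
  by rewrite bE subrr !mulr0.
- move=> i ui0 b; apply: inc_inj.
  by rewrite NE /nu /c !ui0 mul0r mul0r subrr mulr0 rmorph0.
Qed.

End CriticalLine.

HB.instance Definition _ (K : fieldType) (v : discrete_valuation K) :=
  GRing.RMorphism.copy (@integer_val K v) (val : integers v -> K).

Lemma proj_pullbackE (I J : finType) (sigma : J -> I) (l : I -> nat) (k : fieldType)
    (f : {mpoly k[nvars (l \o sigma)]}) :
  proj_pullback f = ev (@mpolyC (nvars l) k)
    (fun a (j : 'I_(l (sigma a))) => 'X_(@cvar I l (sigma a) j)) f.
Proof. by []. Qed.

Lemma ev_pullback (I J : finType) (sigma : J -> I) (l : I -> nat) (k : fieldType)
    (S : comNzRingType) (theta : {rmorphism k -> S}) (h : forall i, 'I_(l i) -> S)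
    (f : {mpoly k[nvars (l \o sigma)]}) :
  ev theta h (proj_pullback f) = ev theta (fun a (j : 'I_(l (sigma a))) => h (sigma a) j) f.
Proof.
rewrite proj_pullbackE; apply: ev_morph => [c|a j]; first exact: evC.
exact: ev_cvar.
Qed.

Lemma map_poly_line (S T : comNzRingType) (g : {rmorphism S -> T}) (a b : S) :
  map_poly g (a%:P + 'X * b%:P) = (g a)%:P + 'X * (g b)%:P.
Proof. by rewrite rmorphD rmorphM /= map_polyX !map_polyC. Qed.

(** * Factorisation of the matrices through the birational factor *)

Section SpecialFibre.
Variables (K : fieldType) (v : discrete_valuation K) (k : fieldType).
Variables (pi : {rmorphism integers v -> k}) (pi_residue : is_residue_field pi).
Variables (I : finType) (l : I -> nat) (d : nat) (A : forall i, 'M[K]_(l i, d)).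

Definition in_fibre (P : pt l k) : Prop :=
  is_point P /\ forall f, multiker (@integer_val K v) A f -> P (map_mpoly pi f).

Hypothesis A_free : forall i, row_free (A i).
Variables (eta : pt l k) (eta_fibre : in_fibre eta).
Hypothesis eta_minimal : forall P, in_fibre P -> (forall f, P f -> eta f) ->
  forall f, eta f -> P f.
Variable i : I.
Hypothesis eta_rational : forall j (a b : 'I_(l j)), ~ eta 'X_(cvar b) ->
  exists e (f' g' : {mpoly k[nvars (l \o (fun _ : unit => i))]}),
    [/\ multihomog e f', multihomog e g', ~ eta (proj_pullback g')
      & eta ('X_(cvar a) * proj_pullback g' - 'X_(cvar b) * proj_pullback f')].

(* Otherwise move the vector x in a direction that A i does not see and A j   *)
(* does see. Along the critical line the special fibre contains a family of   *)
(* points specialising to eta at s = 0, so by minimality eta is its generic   *)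
(* member; but there a ratio of coordinates is nonconstant in s, although by  *)
(* rationality it is a function of the i-th factor, where s is invisible.     *)
Lemma component_factors j : (1 < l j)%N -> (A j <= A i)%MS.
Proof.
move=> lj; apply: contrapT => nAj; have [eta_pt eta_J] := eta_fibre.
pose iota : {rmorphism integers v -> K} := @integer_val K v.
(* A column of the cokernel matrix of [A i] that [A j] does not kill. *)
have [u0 Aiu0 Aju0] : exists2 u0 : 'cV[K]_d, A i *m u0 = 0 & A j *m u0 != 0.
  have : exists c, col c (A j *m cokermx (A i)) != 0.
    apply/existsP; apply: contra_notT nAj => /existsPn col0.
    rewrite submxE; apply/eqP/matrixP => r c.
    by have /negPn/eqP/matrixP/(_ r 0) := col0 c; rewrite !mxE.
  case=> c; rewrite colE -mulmxA -colE => ?; exists (col c (cokermx (A i))) => //.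
  by rewrite colE mulmxA mulmx_coker mul0mx.
have [L [kap [x [t [t0 x_indep evJ]]]]] := generic_field iota A.
pose w j a := t j * (map_mx kap (A j) *m x) a 0.
pose phi : {rmorphism {mpoly (integers v)[nvars l]} -> L} := ev (kap \o iota) w.
have etaP : prime_ideal (fun f => eta (map_mpoly pi f)).
  exact/prime_ideal_point/pullback_point.
have [T [inc [kappa [res [psi [inc_inj inc_val psiE resE]]]]]] :=
  dominating_place (phi := phi) etaP (fun r r0 => eta_J r (evJ r r0)).
pose iT : {rmorphism integers v -> T} := psi \o @mpolyC (nvars l) _.
pose W j (a : 'I_(l j)) := psi 'X_(cvar a).
have incW j' a : inc (W j' a) = w j' a by rewrite /W psiE [phi _]ev_cvar.
have inciT c : inc (iT c) = kap (iota c) by rewrite /iT /= psiE [phi _]evC.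
have psi_ev f : psi f = ev iT W f.
  apply: inc_inj; rewrite psiE; apply/esym/ev_morph => //.
have pi_onto := pi_residue.1.
have pi0 c : pi c = 0 -> res (iT c) = 0.
  move=> c0; apply/resE; rewrite (_ : map_mpoly _ _ = 0); first exact: point0.
  by rewrite map_mpolyC -[RHS]mpolyC0; congr (_%:MP).
have [theta thetaE] := rmorph_factor pi_onto (g := res \o iT) pi0.
pose wb j (a : 'I_(l j)) := res (W j a).
have eta_ev f : eta f <-> ev theta wb f = 0.
  have [g <-] := map_mpoly_onto pi_onto f; rewrite -resE psi_ev.
  rewrite (@ev_map _ _ _ _ _ pi (res \o iT)) //.
  by rewrite -(@ev_morph _ _ _ _ _ iT (res \o iT) res W wb).
have wbE j' a : wb j' a = ev theta wb 'X_(cvar a) by rewrite ev_cvar.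
have [a wba] : exists a : forall j, 'I_(l j), forall j, wb j (a j) != 0.
  apply: (@fin_all_exists _ _ (fun j b => wb j b != 0)) => j'.
  have [b nb] := point_relevant eta_pt j'; exists b.
  by rewrite wbE; apply/eqP => /eta_ev.
pose u j (b : 'I_(l j)) := t j * kap ((A j *m u0) b 0).
(* If [A j *m u0] were proportional to the j-th image of the generic [x], two of its coordinates
   would give a nontrivial linear relation over [K] between the rows of [A j]; this is where
   [1 < l j] enters. *)
have [b1 ub1] : exists b1, u j b1 * inc (W j (a j)) != u j (a j) * inc (W j b1).
  apply: contrapT => nex.
  have {nex} uprop b : u j b * w j (a j) = u j (a j) * w j b.
    by apply/eqP/negPn/negP; rewrite -!incW => ub; apply: nex; exists b.
  have waj0 : w j (a j) != 0 by rewrite -incW; have [] := place_unit inc_inj inc_val (wba j).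
  pose X b := (map_mx kap (A j) *m x) b 0; pose y b := (A j *m u0) b 0.
  have Xaj0 : X (a j) != 0 by apply: contraNneq waj0 => Xa; rewrite /w -/(X (a j)) Xa mulr0.
  have yX b : kap (y b) * X (a j) = kap (y (a j)) * X b.
    apply: (mulfI (t0 j)); apply: (mulfI (t0 j)); have := uprop b.
    rewrite /u /w -/(X (a j)) -/(X b) -/(y b) -/(y (a j)) => yb.
    by rewrite !(mulrA (t j) (t j)) mulrACA yb mulrACA.
  have [r yr] : exists r, y r != 0 by apply/cV0Pn.
  have [s sr] : exists s, s != r.
    have [r0|r0] := eqVneq (val r) 0%N.
      by exists (Ordinal lj); rewrite -val_eqE /= r0.
    by exists (Ordinal (ltnW lj)); rewrite -val_eqE /= eq_sym.
  have ysr : kap (y s) * X r = kap (y r) * X s.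
    by apply: (mulIf Xaj0); rewrite mulrAC yX mulrAC -yX mulrAC.
  pose M := y s *: delta_mx 0 r - y r *: delta_mx 0 s : 'rV[K]_(l j).
  have /(row_free_inj (A_free j)) /matrixP/(_ 0 s) : M *m A j = 0 *m A j.
    rewrite mul0mx; apply: x_indep; rewrite map_mxM -mulmxA.
    rewrite map_mxB !map_mxZ !map_delta_mx mulmxBl -!scalemxAl -!rowE.
    move: (map_mx kap (A j) *m x) @X {Xaj0 yX} ysr => B X ysr.
    by apply/matrixP => p q; rewrite !mxE !ord1 [X in X - _]ysr subrr.
  rewrite !mxE !eqxx (negPf sr) mulr0 mulr1 sub0r => /eqP.
  by rewrite oppr_eq0 (negPf yr).
have := critical_line inc_inj inc_val wba ub1.
move=> [rho [c0 [al [be [N [j0 [b0 [[al0 alres lineE Na] [N1 al1 be0] Nu]]]]]]]].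
(* [H] is the critical line multiplied by [al], with ['X] as the parameter s; [Hb] is its reduction,
   and [eta2] the generic member of the reduced family. *)
pose R1 j b := be j * W j b + al j * N j b.
pose H j b : {poly T} := (al j * W j b)%:P + 'X * (R1 j b)%:P.
pose Hb j b : {poly kappa} := (res (al j) * wb j b)%:P + 'X * (res (R1 j b))%:P.
have HbE j' b : map_poly res (H j' b) = Hb j' b.
  by rewrite /H map_poly_line rmorphM.
pose eta2 := hker (@polyC kappa \o theta) Hb.
have eta2_pt : is_point eta2.
  apply: hker_point => j'; exists (a j'); rewrite /Hb /R1 Na mulr0 addr0 rmorphM.
  apply/eqP => /polyP H0; have := alres j'; have := H0 0%N; have := H0 1%N.
  rewrite !coefD !coefXM !coefC /= !add0r addr0 => H1 {}H0.
  case=> [al1'|[_ be1']]; have := wba j'.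
    by move: H0; rewrite al1' mul1r => ->; rewrite eqxx.
  by move: H1; rewrite be1' mul1r => H1; rewrite /wb H1 eqxx.
have eta2_fibre : in_fibre eta2.
  split=> // f f0 e; rewrite multicomp_map.
  rewrite (@ev_map _ _ _ _ _ pi (@polyC kappa \o (res \o iT))); last first.
    by move=> c /=; rewrite thetaE.
  rewrite -(@ev_morph _ _ _ _ _ (@polyC T \o iT) _ (map_poly res) H) //; last first.
    by move=> c; rewrite /= map_polyC.
  rewrite (_ : ev _ _ _ = 0) ?rmorph0 //.
  have inj_inc : injective (map_poly inc) by apply: map_inj_poly; rewrite ?rmorph0.
  apply: inj_inc; rewrite rmorph0.
  (* Over the polynomials in s, [H] is up to scalars the family of images of this moving vector, so
     it satisfies the equations of the degeneration. *)
  pose x' : 'cV[{poly L}]_d := map_mx polyC x +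
    ('X * rho%:P) *: map_mx polyC (map_mx kap u0 - c0 *: x).
  pose kapX : {rmorphism K -> {poly L}} := @polyC L \o kap.
  rewrite (@ev_morph _ _ _ _ _ _ (kapX \o iota) (map_poly inc) H
    (fun j b => (inc (al j) * t j)%:P * (map_mx kapX (A j) *m x') b 0)).
  - by apply: (multiker_eval (kappa := kapX) (y := x') _ _ f0).
  - by move=> c; rewrite /= map_polyC /= inciT.
  - move=> j' b; apply: etrans (map_poly_line inc _ _) _; rewrite rmorphM.
    rewrite -lineE incW.
    have AC m (M : 'M[K]_(m, d)) (z : 'cV[L]_d) :
        map_mx kapX M *m map_mx polyC z = map_mx polyC (map_mx kap M *m z).
      by rewrite map_mxM -map_mx_comp.
    rewrite /x' mulmxDr -scalemxAr !AC mulmxBr -scalemxAr -map_mxM.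
    rewrite /w /u; move: (_ *m x) (_ *m u0) => B y; rewrite !mxE.
    by rewrite !(polyCM, polyCB); ring.
have eta2_eta f : eta2 f -> eta f.
  move=> f0; apply/eta_ev; rewrite (multicomp_sum f) rmorph_sum big1 // => e _.
  have fe : multihomog e (multicomp e f) by exact: multihomog_multicomp.
  (* Before setting s to 0, the factor s is removed from those vectors whose [al] has residue zero;
     all values at 0 are then [wb]. *)
  pose tau j : {poly kappa} := if res (al j) == 0 then 'X else 1.
  pose h' j b := if res (al j) == 0 then (wb j b)%:P else Hb j b.
  have HbE' j' b : Hb j' b = tau j' * h' j' b.
    rewrite /tau /h' /Hb /R1; case: eqP => [al0'|_]; last by rewrite mul1r.
    case: (alres j') => [al1'|[_ be1']].
      by have := oner_neq0 kappa; rewrite -al1' al0' eqxx.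
    by rewrite rmorphD !rmorphM al0' be1' !mul0r add0r mul1r addr0.
  have h'0 (j' : I) (b : 'I_(l j')) : horner_eval 0 (h' j' b) = wb j' b.
    rewrite /horner_eval /h'; case: eqP => [_|al0']; first by rewrite hornerC.
    have [al1'|[//]] := alres j'.
    by rewrite /Hb al1' !hornerE ?mul0r ?addr0 ?mul1r.
  rewrite /= -(@ev_morph _ _ _ _ _ (@polyC kappa \o theta) theta (horner_eval 0) h') //; last first.
    by move=> c; exact: hornerC.
  have /eqP := f0 e; rewrite (ev_scale _ fe HbE') mulf_eq0 => /orP[|/eqP->]; last first.
    exact: rmorph0.
  move=> /prodf_eq0[j2 _]; rewrite expf_eq0 /tau => /andP[_].
  by case: ifP; rewrite ?polyX_eq0 ?oner_eq0.
have eta_eta2 := eta_minimal eta2_fibre eta2_eta.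
have nb : ~ eta 'X_(cvar (a j0)).
  by move/eta_ev; rewrite -wbE => wb0; have := wba j0; rewrite wb0 eqxx.
have [e [f' [g' [fe ge ng /eta_eta2 /hker_ev]]]] := eta_rational b0 nb.
rewrite rmorphB !rmorphM /= !ev_cvar !ev_pullback => p0.
apply: ng; apply/eta_ev; rewrite ev_pullback.
pose lam : {poly kappa} := (res (al i))%:P + 'X * (res (be i))%:P.
have lam0 : lam != 0.
  apply/eqP => /polyP l0; have := alres i; have := l0 0%N; have := l0 1%N.
  rewrite !coefD !coefXM !coefC /= !add0r addr0 => -> ->.
  by case=> [|[_]] e01; have := oner_neq0 kappa; rewrite -e01 eqxx.
(* [u] vanishes on the i-th factor, so there the line only rescales the vector [wb i] by [lam]. *)
have Hi c : Hb i c = lam * (wb i c)%:P.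
  rewrite /Hb /R1 Nu ?mulr0 ?addr0; last first.
    by move=> b; rewrite /u Aiu0 mxE rmorph0 mulr0.
  by rewrite /lam mulrDl -mulrA -!polyCM rmorphM.
pose ev_i := ev theta (fun (_ : unit) (c : 'I_(l i)) => wb i c).
have evH (q : {mpoly k[nvars (l \o (fun _ : unit => i))]}) : multihomog e q ->
    ev (@polyC kappa \o theta) (fun (_ : unit) (c : 'I_(l i)) => Hb i c) q =
    (\prod_(o : unit) lam ^+ e o) * (ev_i q)%:P.
  move=> qe; rewrite (ev_scale _ qe (fun _ c => Hi c)); congr (_ * _).
  by apply/esym/ev_morph.
(* The [b0] coordinate is now [wb b0] plus s and the [a j0] coordinate is constant; the coefficient
   of s in the relation forces [g'] to vanish at [eta]. *)
move: p0; rewrite [X in X * _ - _]/Hb [X in _ - X * _]/Hb /R1 N1 Na !evH //.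
have -> : res (be j0 * W j0 b0 + al j0 * 1) = 1.
  by rewrite mulr1 rmorphD rmorphM al1 be0 mul0r add0r.
have -> : res (be j0 * W j0 (a j0) + al j0 * 0) = 0.
  by rewrite mulr0 addr0 rmorphM be0 mul0r.
rewrite al1 !mul1r mulr1 mulr0 addr0 mulrCA [X in _ - X]mulrCA -mulrBr => /eqP.
rewrite mulf_eq0 => /orP[/prodf_eq0[o _]|/eqP/polyP/(_ 1%N)].
  by rewrite expf_eq0 (negPf lam0) andbF.
rewrite mulrDl -!polyCM !(coefB, coefD) coefXM !coefC /=.
by rewrite subr0 add0r.
Qed.

End SpecialFibre.

(** * The ideal of a component in terms of reduced matrices *)

Lemma integers_valuation (K : fieldType) (v : discrete_valuation K) (k : fieldType)
    (pi : {rmorphism integers v -> k}) : is_residue_field pi ->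
  forall x : K, (exists y : integers v, integer_val y = x) \/
    (exists2 y : integers v, integer_val y = x^-1 & pi y = 0).
Proof.
move=> [_ pi0] x; have [->|x0] := eqVneq x 0; first by left; exists 0; rewrite rmorph0.
have v1 : v 1 = 0.
  by apply: (@addrI _ (v 1)); rewrite addr0 -dvalM ?oner_neq0 // mulr1.
have vV : v x^-1 = - v x.
  by apply: (@addrI _ (v x)); rewrite -dvalM ?invr_eq0 // mulfV // subrr.
have [vx|vx] := leP 0 (v x).
  have xI : x \in integral v by rewrite unfold_in /integral vx orbT.
  by left; exists (Integer xI).
have xI : x^-1 \in integral v by rewrite unfold_in /integral vV oppr_ge0 ltW ?orbT.
by right; exists (Integer xI) => //; apply/pi0; right; rewrite /= vV oppr_gt0.
Qed.

Lemma ev_self (I : finType) (l : I -> nat) (R : comNzRingType) (f : {mpoly R[nvars l]}) :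
  ev (@mpolyC (nvars l) R) (fun i j => 'X_(@cvar I l i j)) f = f.
Proof.
elim/mpolyind: f => [|c m f _ _ IH]; first exact: rmorph0.
rewrite rmorphD /= IH evZ mul_mpolyC /ev mmapX -[in RHS](mmap1_id _ m); congr (_ *: _ + _).
apply: mmap1_eq => w; rewrite /cvar; congr ('X_(_)).
by rewrite -[RHS]enum_valK; congr enum_rank; case: (enum_val w).
Qed.

Section ComponentKernel.
Variables (K : fieldType) (v : discrete_valuation K) (k : fieldType).
Variables (pi : {rmorphism integers v -> k}) (pi_residue : is_residue_field pi).
Variables (I : finType) (l : I -> nat) (d : nat) (A : forall i, 'M[K]_(l i, d)).
Hypotheses (l_gt0 : forall i, (0 < l i)%N) (A_neq0 : forall i, A i != 0).
Variables (eta : pt l k) (eta_fibre : in_fibre pi A eta).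
Variable i : I.
Hypothesis A_factor : forall j, (1 < l j)%N -> (A j <= A i)%MS.
Hypothesis eta_dominant : forall f : {mpoly k[nvars (l \o (fun _ : unit => i))]},
  eta (proj_pullback f) -> f = 0.

Definition lincomb (R : comNzRingType) m (B : 'M[R]_(m, l i)) b : {mpoly R[nvars l]} :=
  \sum_c B b c *: 'X_(@cvar I l i c).

(** The factor [C] in [A j = C *m A i] is divided by an entry of least valuation, so one entry of
    the integral matrix [B] is 1 and its reduction is nonzero. The minors vanish on the generic
    fibre, hence at [eta]. With a single row, [a = b] and any nonzero matrix will do. *)
Lemma residue_matrix j : exists2 B : 'M[k]_(l j, l i), B != 0 &
  forall a b, eta ('X_(cvar a) * lincomb B b - 'X_(cvar b) * lincomb B a).
Proof.
have [eta_pt eta_J] := eta_fibre.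
have [lj|lj] := leqP (l j) 1.
  exists (const_mx 1).
    apply/eqP => /matrixP/(_ (Ordinal (l_gt0 j)) (Ordinal (l_gt0 i))) /eqP.
    by rewrite !mxE oner_eq0.
  move=> a b; have -> : a = b.
    have ord0 (c : 'I_(l j)) : val c = 0%N.
      by apply/eqP; rewrite -leqn0 -ltnS (leq_trans (ltn_ord c)).
    by apply: val_inj; rewrite !ord0.
  by rewrite subrr; exact: point0.
have /submxP[C CE] := A_factor lj.
pose iota : {rmorphism integers v -> K} := @integer_val K v.
have [r [s Crs]] : exists r s, C r s != 0.
  apply: contrapT => nC; move: (A_neq0 j); rewrite CE (_ : C = 0) ?mul0mx ?eqxx //.
  apply/matrixP => r s; rewrite mxE; apply/eqP/negPn/negP => Crs.
  by apply: nC; exists r, s.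
have iota_inj : injective iota by exact: val_inj.
have [[r0 s0] maxC] := place_preorder_max (inc := iota)
  (integers_valuation pi_residue) (r, s) (fun p => C p.1 p.2).
have m0 : C r0 s0 != 0.
  by have [y] := maxC (r, s); apply: contra_eq_neq => /= ->; rewrite mulr0.
pose m := C r0 s0.
have [B0 B0E] : exists B0 : 'I_(l j) * 'I_(l i) -> integers v,
    forall p, iota (B0 p) * m = C p.1 p.2.
  apply: (@fin_all_exists _ _ (fun p y => iota y * m = C p.1 p.2)) => p.
  by have [y yE] := maxC p; exists y.
pose B := \matrix_(p, q) B0 (p, q).
exists (map_mx pi B).
  apply/eqP => /matrixP/(_ r0 s0) /eqP; rewrite !mxE.
  rewrite (_ : B0 (r0, s0) = 1) ?rmorph1 ?oner_eq0 //.
  by apply: iota_inj; rewrite rmorph1; apply: (mulIf m0); rewrite B0E mul1r.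
have CB : C = m *: map_mx iota B.
  by apply/matrixP => p q; rewrite !mxE mulrC B0E.
move=> a b; pose g := 'X_(cvar a) * lincomb B b - 'X_(cvar b) * lincomb B a.
have lincomb_map c : map_mpoly pi (lincomb B c) = lincomb (map_mx pi B) c.
  by rewrite /lincomb rmorph_sum; apply: eq_bigr => p _; rewrite /= map_mpolyZ map_mpolyX !mxE.
have <- : map_mpoly pi g = 'X_(cvar a) * lincomb (map_mx pi B) b -
    'X_(cvar b) * lincomb (map_mx pi B) a.
  by rewrite rmorphB !rmorphM /= !map_mpolyX !lincomb_map.
apply: eta_J; have [L [kap [x [t [t0 _]]]]] := generic_field iota A; apply.
rewrite rmorphB !rmorphM /= !ev_cvar.
have evl c : kap m * ev (kap \o iota) (fun j a => t j * (map_mx kap (A j) *m x) a 0)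
    (lincomb B c) = t i * (map_mx kap (A j) *m x) c 0.
  rewrite CE CB -scalemxAl map_mxZ map_mxM -scalemxAl -mulmxA [in RHS]mxE.
  rewrite mulrCA; congr (_ * _); rewrite rmorph_sum [in RHS]mxE mulr_sumr.
  apply: eq_bigr => p _; rewrite /= evZ ev_cvar mulrCA; congr (_ * _).
  by rewrite !mxE.
have kapm0 : kap m != 0 by rewrite fmorph_eq0.
apply: (mulfI kapm0); rewrite mulr0 mulrBr ![kap m * (_ * _)]mulrCA !evl.
by rewrite mulrACA [X in X - _]mulrC mulrACA; ring.
Qed.

(* On the component the 2 x 2 minors say that the j-th vector is proportional *)
(* to B j times the i-th one, whose coordinates are independent.              *)
Lemma component_kernel : exists B : forall j, 'M[k]_(l j, l i),
  (forall j, B j != 0) /\ forall f, eta f <-> multiker idfun B f.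
Proof.
have [eta_pt _] := eta_fibre.
have [B BP] : exists B : forall j, 'M[k]_(l j, l i), forall j, B j != 0 /\
    forall a b : 'I_(l j), eta ('X_(cvar a) * lincomb (B j) b - 'X_(cvar b) * lincomb (B j) a).
  apply: (@fin_all_exists _ _ (fun j M => M != 0 /\ forall a b : 'I_(l j),
    eta ('X_(cvar a) * lincomb M b - 'X_(cvar b) * lincomb M a))) => j.
  by have [M M0 MP] := residue_matrix j; exists M.
exists B; split=> [j|]; first by have [] := BP j.
have [D [q qE]] := prime_ideal_kernel (prime_ideal_point eta_pt).
pose pp : {rmorphism {mpoly k[nvars (l \o (fun _ : unit => i))]} -> {mpoly k[nvars l]}} :=
  ev (@mpolyC (nvars l) k) (fun (_ : unit) (c : 'I_(l i)) => 'X_(@cvar I l i c)).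
have qpp f : q (pp f) = 0 <-> f = 0.
  by split=> [/qE/eta_dominant//|->]; rewrite !rmorph0.
have ppl j b : pp (@linform I l k (l i) B j b) = lincomb (B j) b.
  rewrite /linform rmorph_sum; apply: eq_bigr => c _; rewrite [LHS]evZ.
  by rewrite mul_mpolyC; congr (_ *: _); exact: ev_cvar.
pose w j (a : 'I_(l j)) := q 'X_(cvar a).
pose z j b := q (lincomb (B j) b).
have minor j a b : w j a * z j b = w j b * z j a.
  apply/eqP; rewrite -subr_eq0 -!rmorphM -rmorphB; apply/eqP/qE.
  by have [_] := BP j; apply.
(* A nonzero row of [B j] gives a nonzero linear form in the i-th coordinates, which by dominance
   does not vanish at [eta]. *)
have [b zb] : exists b : forall j, 'I_(l j), forall j, z j (b j) != 0.
  apply: (@fin_all_exists _ _ (fun j b => z j b != 0)) => j.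
  have [/matrix_row_neq0[b rowb] _] := BP j; exists b.
  rewrite /z -ppl; apply/eqP => /qpp/eqP; exact/negP/linform_neq0.
have wb j : w j (b j) != 0.
  have [a na] := point_relevant eta_pt j; have wa : w j a != 0 by apply/eqP => /qE.
  have : w j a * z j (b j) != 0 by rewrite mulf_neq0.
  by rewrite minor; apply: contraNneq => ->; rewrite mul0r.
have q_ev f : q f = ev (q \o @mpolyC (nvars l) k) w f.
  by rewrite -{1}(ev_self f); apply: ev_morph.
pose qC : {rmorphism k -> D} := q \o @mpolyC (nvars l) k.
move=> f; rewrite (point_multicomp f eta_pt).
suff evE e : eta (multicomp e f) <-> linsubst idfun B (multicomp e f) = 0.
  by split=> ef e; apply/(evE e)/(ef e).
have fe : multihomog e (multicomp e f) by exact: multihomog_multicomp.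
rewrite -qE q_ev -qpp.
have -> : q (pp (linsubst idfun B (multicomp e f))) = ev qC z (multicomp e f).
  apply: (@ev_morph _ _ _ _ _ (@mpolyC _ k \o idfun) qC (q \o pp) (@linform I l k (l i) B)).
    by move=> c /=; congr (q _); exact: evC.
  by move=> j c /=; rewrite ppl.
(* By [minor], [w] scaled by [z j (b j)] equals [z] scaled by [w j (b j)]; homogeneity compares the
   two evaluations up to nonzero factors. *)
have : (\prod_j z j (b j) ^+ e j) * ev qC w (multicomp e f) =
    (\prod_j w j (b j) ^+ e j) * ev qC z (multicomp e f).
  rewrite -(ev_scale _ fe (fun j c => erefl (z j (b j) * w j c))).
  by apply: ev_scale => // j c; rewrite mulrC minor.
have prod0 (g : forall j, 'I_(l j) -> D) : (forall j, g j (b j) != 0) ->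
    \prod_j g j (b j) ^+ e j != 0.
  by move=> g0; apply/prodf_neq0 => j _; rewrite expf_neq0.
move=> evE; split=> ev0; move: evE; rewrite ev0 mulr0.
  by move/esym/eqP; rewrite mulf_eq0 (negPf (prod0 w wb)) => /eqP.
by move/eqP; rewrite mulf_eq0 (negPf (prod0 z zb)) => /eqP.
Qed.

End ComponentKernel.

(** * Components of Mustafin degenerations *)

Lemma row_free_neq0 (F : fieldType) m n (A : 'M[F]_(m, n)) :
  (0 < m)%N -> row_free A -> A != 0.
Proof.
by move=> m0; apply: contraTneq => ->; rewrite /row_free mxrank0 eq_sym -lt0n.
Qed.

(** * Matrices of quotient lattices have full row rank *)

Section QuotientLatticeMatrix.
Variables (K : fieldType) (v : discrete_valuation K) (k : fieldType).
Variables (pi : {rmorphism integers v -> k}) (pi_residue : is_residue_field pi).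
Variables (V : vectType K) (q : quotLattice v V).

Lemma qlbasis_free : free [tuple of qlbasis q ++ qlM_basis q].
Proof.
pose iota : {rmorphism integers v -> K} := @integer_val K v.
have iota_inj : injective iota by exact: val_inj.
have [_ _ basL] := qlbasisP q; have [basM freeM] := qlM_basisP q.
apply/freeP => c c0.
(* Adding 1 to the family of coefficients makes the common divisor [m] nonzero; dividing by it turns
   the relation into an integral one. *)
have [o oP] := place_preorder_max (inc := iota) (integers_valuation pi_residue)
  None (fun p => if p is Some j then c j else 1).
set m := (if o is Some j then c j else 1) in oP.
have m0 : m != 0.
  by have [y /esym/eqP] := oP None; apply: contraTneq => ->; rewrite mulr0 eq_sym oner_neq0.
have [y yE] : exists y : 'I_(qlrank q + qlM_rank q) -> integers v,
    forall j, c j = iota (y j) * m.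
  by apply: (@fin_all_exists _ _ (fun j y => c j = iota y * m)) => j; exact: (oP (Some j)).
have {}c0 : icomb (qlbasis q) (fun j => y (lshift _ j)) +
    icomb (qlM_basis q) (fun j => y (rshift _ j)) = 0.
  apply: (scalerI m0); rewrite scaler0 -[RHS]c0 big_split_ord /= scalerDr.
  congr (_ + _); rewrite /icomb scaler_sumr; apply: eq_bigr => j _.
    by rewrite scalerA mulrC -[_ * m]yE nth_cat size_tuple ltn_ord (tnth_nth 0).
  rewrite scalerA mulrC -[_ * m]yE nth_cat size_tuple ltnNge leq_addr addKn.
  by rewrite (tnth_nth 0).
have yl j : y (lshift _ j) = 0.
  apply: (basL (fun j => y (lshift _ j))); apply/basM.
  exists (fun j => - y (rshift _ j)); move/eqP: c0; rewrite addr_eq0 => /eqP->.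
  by rewrite /icomb -sumrN; apply: eq_bigr => p _; rewrite -scaleNr rmorphN.
have yr j : y (rshift _ j) = 0.
  apply: (freeM (fun j => y (rshift _ j))); rewrite -[RHS]c0.
  by rewrite [X in _ = X + _]big1 ?add0r // => p _; rewrite yl rmorph0 scale0r.
by move=> j; rewrite yE; case: (split_ordP j) => p ->; rewrite ?yl ?yr rmorph0 mul0r.
Qed.

Lemma qlmx_free : row_free (qlmx q).
Proof.
apply/row_freeP.
exists (\matrix_(c, j) coord (vbasis {:V}) c (tnth (qlbasis q) j)).
apply/matrixP => j j'; rewrite !mxE.
under eq_bigr do rewrite !mxE /qlcoord mulrC -linearZ.
rewrite -linear_sum /=.
have -> : \sum_c coord (vbasis {:V}) c (tnth (qlbasis q) j') *: tnth (vbasis {:V}) c =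
    tnth (qlbasis q) j'.
  rewrite [RHS](coord_vbasis (memvf _)); apply: eq_bigr => c _.
  by congr (_ *: _); exact: tnth_nth.
rewrite -(tnth_lshift _ (qlM_basis q)) (tnth_nth 0) coord_free ?qlbasis_free //.
by rewrite eq_sym (inj_eq (@lshift_inj _ _)).
Qed.

End QuotientLatticeMatrix.

Lemma multiview_of_kernel (I : finType) (l : I -> nat) (k : fieldType)
    (C : pt l k -> Prop) (d : nat) (B : forall j, 'M[k]_(l j, d)) :
    (0 < d)%N -> (forall j, 0 < l j)%N -> (forall j, B j != 0) ->
    (forall P, C P <-> is_point P /\ forall f, multiker idfun B f -> P f) ->
  is_multiview C.
Proof.
(* Zero columns are appended to have l j <= d. *)
move=> d0 l0 B0 CE; pose N := (\sum_j l j)%N.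
pose B' j : 'M[k]_(l j, d + N) := row_mx (B j) 0.
have B'0 j : B' j != 0.
  apply: contraNneq (B0 j) => B'j; rewrite -(row_mxKl (B j) (0 : 'M_(_, N))).
  by rewrite [row_mx _ _]B'j linear0.
exists (d + N)%N, B'; split=> [|j|//|P].
- by rewrite addn_gt0 d0.
- by rewrite l0 /= /N (bigD1 j) //= addnCA leq_addr.
pose X n : 'cV[{mpoly k[nvars (unit_dim n)]}]_n := \col_c 'X_(@cvar _ (unit_dim n) tt c).
have kerE f : multiker idfun B' f <-> multiker idfun B f.
  split.
  - apply: (multiker_eval (kappa := @mpolyC (nvars (unit_dim d)) k)
      (y := col_mx (X d) 0) (c := fun=> 1)) => // j a.
    rewrite mul1r /B' map_row_mx mul_row_col mulmx0 addr0 mxE.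
    by apply: eq_bigr => c _; rewrite !mxE mul_mpolyC.
  - apply: (multiker_eval (kappa := @mpolyC (nvars (unit_dim (d + N))) k)
      (y := usubmx (X (d + N)%N)) (c := fun=> 1)) => // j a.
    rewrite mul1r mxE /linform big_split_ord /= [X in _ + X]big1 ?addr0; last first.
      by move=> c _; rewrite row_mxEr mxE scale0r.
    by apply: eq_bigr => c _; rewrite row_mxEl !mxE mul_mpolyC.
rewrite CE; symmetry; apply: (iff_trans (linmap_closureP idfun _ B'0 P)).
  by rewrite addn_gt0 d0.
by split=> -[PP kP]; split=> // f /kerE/kP.
Qed.

Lemma multihomog_cvar (I : finType) (l : I -> nat) (R : comNzRingType) i (a b : 'I_(l i)) :
  multihomog (multideg U_(cvar b)%MM) ('X_(cvar a) : {mpoly R[nvars l]}).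
Proof.
have degE (c : 'I_(l i)) : multideg U_(cvar c)%MM = [ffun j => (j == i) : nat].
  apply/ffunP => j; rewrite !ffunE; have [->|ji] := eqVneq j i.
    rewrite (bigD1 c) //= mnm1E eqxx big1 // => p pc; rewrite mnm1E.
    rewrite (inj_eq enum_rank_inj) eq_Tagged /=.
    by rewrite eq_sym (negPf pc).
  rewrite big1 // => p _; rewrite mnm1E (inj_eq enum_rank_inj) -tag_eqE /tag_eq /=.
  by rewrite eq_sym (negPf ji).
by move=> m; rewrite msuppX inE => /eqP->; rewrite !degE.
Qed.

(** Components are taken before pulling back because a non-injective [sigma] merges multidegrees. *)
Lemma hker_pullback (I J : finType) (sigma : J -> I) (l : I -> nat) (k : fieldType)
    (S : idomainType) (theta : {rmorphism k -> S}) (h : forall i, 'I_(l i) -> S)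
    (f : {mpoly k[nvars (l \o sigma)]}) :
  (forall e, hker theta h (proj_pullback (multicomp e f))) <->
  hker theta (fun a (j : 'I_(l (sigma a))) => h (sigma a) j) f.
Proof.
split=> f0 e; first by rewrite -[RHS](hker_ev (f0 e)) ev_pullback.
have fe : multihomog e (multicomp e f) by exact: multihomog_multicomp.
apply/hkerE; rewrite /gev ev_pullback.
rewrite (@ev_scale _ _ _ _ _ (fun a => 'X_(enum_rank (sigma a)))
  (fun a (j : 'I_(l (sigma a))) => (h (sigma a) j)%:MP) _ _ _ fe) //.
rewrite -(@ev_morph _ _ _ _ _ theta _ (@mpolyC #|I| S)
  (fun a (j : 'I_(l (sigma a))) => h (sigma a) j)) //.
by rewrite f0 rmorph0 mulr0.
Qed.

Section Components.
Variables (K : fieldType) (v : discrete_valuation K) (k : fieldType).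
Variables (pi : {rmorphism integers v -> k}) (pi_residue : is_residue_field pi).
Variables (V : vectType K) (I : finType) (Gamma : I -> quotLattice v V).
Implicit Types (C : pt (ranks Gamma) k -> Prop) (P eta : pt (ranks Gamma) k).

Let A i := qlmx (Gamma i).

Lemma special_fibreE P : (0 < \dim {:V})%N -> special_fibre pi P <-> in_fibre pi A P.
Proof.
move=> d0; have A0 i : A i != 0.
  exact: row_free_neq0 (qlrank_gt0 _) (qlmx_free pi_residue _).
split=> -[PP mP]; split=> //.
  by have /linmap_closureP[] := mP.
by apply/linmap_closureP => //; split=> //; exact: pullback_point.
Qed.

(** The zero set of any point of the fibre contained in [eta] is irreducible, lies in the fibre and
    contains [C]; maximality of [C] makes it equal to [C]. *)
Lemma component_generic C eta : (0 < \dim {:V})%N ->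
    component pi C -> generic_point C eta ->
  [/\ in_fibre pi A eta,
      forall P, in_fibre pi A P -> (forall f, P f -> eta f) -> forall f, eta f -> P f
    & forall P, C P <-> is_point P /\ forall f, eta f -> P f].
Proof.
move=> d0 [[Cpt _ _] CX Cmax] [Ceta geneta].
have etaX : in_fibre pi A eta by apply/special_fibreE => //; exact: CX.
have closed eta' : in_fibre pi A eta' -> (forall f, eta' f -> eta f) ->
    forall P, is_point P -> (forall f, eta' f -> P f) -> C P.
  move=> [eta'_pt eta'J] eta'eta P PP etaP.
  apply: (Cmax (fun P => is_point P /\ forall f, eta' f -> P f)) => //.
  - split=> [Q []|| E1 E2 E12] //; first by exists eta'.
    by case: (E12 eta') => // -[_ E]; [left|right] => Q [PQ etaQ]; split=> // f /E/etaQ.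
  - move=> Q [PQ etaQ]; apply/special_fibreE => //; split=> // f /eta'J; exact: etaQ.
  - by move=> Q CQ; split=> [|f /eta'eta/(geneta Q CQ)//]; exact: Cpt.
split=> // [P PX Peta|P].
  by apply: geneta; apply: (closed P) => //; case: PX.
split=> [CP|[PP etaP]]; last exact: (closed eta).
by split; [exact: Cpt|exact: geneta].
Qed.

Lemma primary_kernel C eta i : primary_at pi i C -> generic_point C eta ->
  [/\ (0 < \dim {:V})%N, forall P, C P <-> is_point P /\ forall f, eta f -> P f
    & exists B : forall j, 'M[k]_(ranks Gamma j, ranks Gamma i),
      (forall j, B j != 0) /\ forall f, eta f <-> multiker idfun B f].
Proof.
move=> [Ccomp [eta1 [theta [geneta1 gentheta thetaE bir]]]] geneta.
have rk0 j : (0 < ranks Gamma j)%N by exact: qlrank_gt0.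
have Afree j : row_free (A j) by exact: (qlmx_free pi_residue).
have A0 j : A j != 0 by exact: row_free_neq0 (rk0 j) (Afree j).
have d0 : (0 < \dim {:V})%N.
  have := rank_leq_col (A i); rewrite (eqP (Afree i)); exact: leq_trans (rk0 i).
have [etaX etamin CE] := component_generic d0 Ccomp geneta.
have eta1E : eta1 = eta.
  by apply: eq_pred => f; split; [exact: (geneta1.2 _ geneta.1)|exact: (geneta.2 _ geneta1.1)].
move: eta1E thetaE bir => -> thetaE bir.
(* The target is a whole projective space, so its generic point is the zero ideal. *)
have theta0 f : theta f -> f = 0.
  by move/(gentheta.2 (fun g => g = 0)); apply; apply: zero_point => u; exact: rk0.
split=> //; apply: (component_kernel pi_residue rk0 A0 etaX (i := i)) => [|f /thetaE/theta0//].
apply: (component_factors pi_residue Afree etaX etamin (i := i)) => j a b nb.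
have [e [f' [g' [fe ge ng p0]]]] := bir _ 'X_(cvar a) 'X_(cvar b)
  (@multihomog_cvar I (ranks Gamma) k j a b) (@multihomog_cvar I (ranks Gamma) k j b b) nb.
by exists e, f', g'; split=> //; rewrite -thetaE.
Qed.

End Components.

Theorem proposition4p4 (K : fieldType) (v : discrete_valuation K)
    (k : fieldType) (pi : {rmorphism integers v -> k})
    (pi_residue : is_residue_field pi)
    (V : vectType K) (I : finType) (Gamma : I -> quotLattice v V)
    (Gamma_distinct : forall i j, homothetic (Gamma i) (Gamma j) -> i = j)
    (C : pt (ranks Gamma) k -> Prop) :
  primary pi C \/ secondary pi C -> is_multiview C.
Proof.
have rk0 q : (0 < @qlrank K v V q)%N by exact: qlrank_gt0.
case=> [[i Cprim]|[Ccomp _ [q _ [D [Dprim [eta [theta [geneta gentheta thetaE _]]]]]]]].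
  have [eta [_ [geneta _ _ _]]] := Cprim.2.
  have [_ CE [B [B0 etaE]]] := primary_kernel pi_residue Cprim geneta.
  apply: (multiview_of_kernel (rk0 _) (fun j => rk0 _) B0) => P; rewrite CE.
  by split=> -[PP kP]; split=> // f /etaE/kP.
(* In the secondary case [theta] is the contraction of [eta] along the projection forgetting the
   factor [None], so dropping [B None] leaves the matrices for [C], with source dimension the rank
   of [q]. *)
have [d0 _ [B [B0 etaE]]] := primary_kernel pi_residue Dprim geneta.
have [[theta_pt _] _ CE] := component_generic pi_residue d0 Ccomp gentheta.
pose B' j : 'M[k]_(ranks Gamma j, qlrank q) := B (Some j).
have thetaB f : theta f <-> multiker idfun B' f.
  rewrite (point_multicomp f theta_pt); apply: (iff_trans _ (@hker_pullback (option I) I Some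
    (ranks (extend Gamma q)) k _ (@mpolyC _ k \o idfun) (@linform _ _ k _ B) f)).
  by split=> f0 e; apply/etaE/thetaE/f0 || apply/thetaE/etaE/f0.
apply: (multiview_of_kernel (rk0 q) (fun j => rk0 _) (fun j => B0 (Some j))) => P.
rewrite CE; split=> -[PP kP]; split=> // f /thetaB; exact: kP.
Qed.
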